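(* Let $(\mathfrak h,(H_i,L_i)_{i\in I})$ be a linear Coxeter system with linear Coxeter group $\mathcal W$ and imaginary cone $Z=\bigcup_{\sigma\in\mathcal W}\sigma K$. (a) Let $\Theta\subseteq I$ be special facial. Then $$\mathrm{ri}(F(\Theta))=\mathcal W_\Theta\,K(\Theta).$$ (b) Every $\mathcal W$-orbit of $\mathrm{Fa}(Z)$ contains exactly one of the faces $F(\Theta)$, $\Theta$ special facial. A face $F\in\mathrm{Fa}(Z)$ is of the form $F(\Theta)$, $\Theta$ special facial, if and only if $\mathrm{ri}(F)\cap K=\mathrm{ri}(F)\cap(-\overline C^\vee)\ne\emptyset$.
   Context: $\mathbb R^+_0=[0,\infty)$, $\mathbb R^+=(0,\infty)$. A convex cone is a subset of a real vector space closed under addition and under multiplication by elements of $\mathbb R^+$. $\mathrm{ri}$ denotes the relative interior of a finite-dimensional convex set. For a convex cone $K$ containing $0$, a face of $K$ is a convex cone $F\subseteq K$ with $(K\setminus F)+K\subseteq K\setminus F$; $\mathrm{Fa}(K)$ is the set of nonempty faces, ordered by inclusion. Linear Coxeter systems. Let $\mathfrak h$ be a finite-dimensional real vector space, $n\ge1$, $I=\{1,\dots,n\}$. For a zero-based closed ray $H\subseteq\mathfrak h$ put $H^{\ge0}=\{\lambda\in\mathfrak h^*\mid\lambda(h)\ge0\ \forall h\in H\}$, $H^{>0}=\{\lambda\mid\lambda(h)>0\ \forall h\in H\setminus\{0\}\}$, $H^{=0}=\{\lambda\mid\lambda(h)=0\ \forall h\in H\}$. A linear Coxeter system $(\mathfrak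 h,(H_i,L_i)_{i\in I})$ consists of zero-based closed rays $H_i\subseteq\mathfrak h$, $L_i\subseteq\mathfrak h^*$ with $L_i\setminus\{0\}\subseteq H_i^{>0}$ such that: (1) the closed fundamental chamber $\overline C=\bigcap_{i\in I}H_i^{\ge0}$ spans $\mathfrak h^*$, and $\overline C\cap H_i^{=0}$, $i\in I$, are its pairwise different faces of codimension 1; (2) with $C=\bigcap_{i\in I}H_i^{>0}$ and $\mathcal W$ (the linear Coxeter group) the group generated by the reflections $\sigma_i$ on $\mathfrak h^*$ at the hyperplane $H_i^{=0}$ along the line $L_i\cup(-L_i)$, one has $\sigma C\cap C=\emptyset$ for all $\sigma\in\mathcal W\setminus\{1\}$. $\mathcal W_J$ is the subgroup generated by $\sigma_j$, $j\in J$. For each $i$ fix $h_i\in H_i$, $\alpha_i\in L_i$ with $\alpha_i(h_i)=2$ (nothing below depends on the choice), and set $A=(a_{ij})_{i,j\in I}$, $a_{ij}=\alpha_j(h_i)$. $\mathcal W$ acts dually on $\mathfrak h$, with $\sigma_ih=h-\alpha_i(h)h_i$. $J\subseteq I$ is facial if $\sum_{j\in J}\mathbb R^+_0h_j$ is a face of $\sum_{i\in I}\mathbb R_0^+h_i$ (empty sum $=\{0\}$). Sets $J,K\subseteq I$ are separated if $a_{jk}=0$ for all $j\in J,k\in K$; a nonempty set is connected if it is not a disjoint union of two nonempty separated subsets; connected components are the maximal nonempty connected subsets. A nonempty connected $J$ is of finite, affine, indefinite type if there is $u\in(\mathbb R^+)^J$ such that all entries of $(a_{ij})_{i,j\in J}\,u$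 are positive, zero, negative, respectively (exactly one case occurs). $J$ is special if none of its components is of finite type (so $\emptyset$ is special). Special facial means special and facial. Imaginary cone. $\overline C^\vee=\{h\in\mathfrak h\mid\alpha_i(h)\ge0\ \forall i\in I\}$, $K=\big(\sum_{i\in I}\mathbb R^+_0h_i\big)\cap(-\overline C^\vee)$, and $Z=\bigcup_{\sigma\in\mathcal W}\sigma K$, which is a convex cone in $\mathfrak h$. For $\Theta$ special facial: $K(\Theta)=\big(\sum_{i\in\Theta}\mathbb R^+h_i\big)\cap(-\overline C^\vee)$, $\overline{K(\Theta)}=\big(\sum_{i\in\Theta}\mathbb R_0^+h_i\big)\cap(-\overline C^\vee)$ (empty sums are $\{0\}$), and $F(\Theta):=\mathcal W_\Theta\,\overline{K(\Theta)}$, which is a face of $Z$. *)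

(* Defs.v *)
From HB Require Import structures.
From mathcomp Require Import all_boot all_order all_algebra.
From mathcomp Require Import all_classical all_reals all_analysis.

Set Implicit Arguments.
Unset Strict Implicit.
Unset Printing Implicit Defensive.

Import Order.TTheory GRing.Theory Num.Theory.
Import numFieldNormedType.Exports.
Import VectorInternalTheory.

Local Open Scope classical_set_scope.
Local Open Scope ring_scope.

Section Convexity.
Variables (R : realType) (V : vectType R).
Implicit Types (S K F : set V).

Definition oppset S : set V := [set - x | x in S].

Definition convex_cone S : Prop :=
  (forall x y, S x -> S y -> S (x + y)) /\
  (forall (c : R) x, 0 < c -> S x -> S (c *: x)).

Definition face K F : Prop :=
  [/\ convex_cone F, F `<=` K &
      forall x y, (K `\` F) x -> K y -> (K `\` F) (x + y)].

Definition Fa K : set (set V) := [set F | face K F /\ F !=set0].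

Definition linear_span S (U : {vspace V}) : Prop :=
  S `<=` [set` U] /\ forall U' : {vspace V}, S `<=` [set` U'] -> (U <= U')%VS.

(* For a nonempty convex cone, the dimension is that of its linear span. *)
Definition codim1_face K F : Prop :=
  Fa K F /\ exists UK UF : {vspace V},
    [/\ linear_span K UK, linear_span F UF & \dim UK = (\dim UF).+1].

Definition affine_hull S : set V :=
  [set x | exists (m : nat) (t : 'I_m -> R) (p : 'I_m -> V),
     [/\ forall i, S (p i), \sum_(i < m) t i = 1 &
         x = \sum_(i < m) t i *: p i]].

(* A vectType carries no topology; its canonical one is transported from row
   vectors along the coordinate isomorphism v2r : V -> 'rV_(dim V); it does not
   depend on that choice of coordinates. *)
Definition ri S : set V :=
  [set x | S x /\
     \forall u \near nbhs (v2r x), affine_hull S (r2v u) -> S (r2v u)].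

Definition closed_ray S : Prop :=
  exists2 v : V, v != 0 & S = [set c *: v | c in [set c : R | 0 <= c]].

Definition reflection_at_along (M D : set V) (s : 'End(V)) : Prop :=
  (forall x, M x -> s x = x) /\ (forall x, D x -> s x = - x).

Inductive generated_group (S : set 'End(V)) : 'End(V) -> Prop :=
| generated_one : generated_group S \1%VF
| generated_incl s : S s -> generated_group S s
| generated_comp s t : generated_group S s -> generated_group S t ->
    generated_group S (s \o t)%VF
| generated_inv s : generated_group S s -> generated_group S (s^-1)%VF.

End Convexity.

Section LinearCoxeterSystem.
Variables (R : realType) (V : vectType R) (n : nat).
Local Notation dualV := 'Hom(V, R^o).

Definition ray_ge0 (A : set V) : set dualV :=
  [set l | forall x, A x -> 0 <= (l x : R)].
Definition ray_gt0 (A : set V) : set dualV :=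
  [set l | forall x, A x -> x != 0 -> 0 < (l x : R)].
Definition ray_eq0 (A : set V) : set dualV :=
  [set l | forall x, A x -> l x = 0].

Variables (H : 'I_n -> set V) (L : 'I_n -> set dualV).

Definition closed_chamber : set dualV := \bigcap_(i in setT) ray_ge0 (H i).
Definition open_chamber : set dualV := \bigcap_(i in setT) ray_gt0 (H i).

Definition coxeter_subgroup (J : {set 'I_n}) : set 'End(dualV) :=
  generated_group [set s | exists2 i, i \in J &
    reflection_at_along (ray_eq0 (H i)) (L i `|` oppset (L i)) s].

Definition coxeter_group : set 'End(dualV) := coxeter_subgroup [set: 'I_n].

Record linear_coxeter_system : Prop := LinearCoxeterSystem {
  lcs_n_gt0 : (0 < n)%N;
  lcs_rayH : forall i, closed_ray (H i);
  lcs_rayL : forall i, closed_ray (L i);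
  lcs_pos : forall i, L i `\ 0 `<=` ray_gt0 (H i);
  lcs_span : linear_span closed_chamber fullv;
  lcs_facets : set_bij setT [set F | codim1_face closed_chamber F]
    (fun i => closed_chamber `&` ray_eq0 (H i));
  lcs_chamber : forall w, coxeter_group w -> w <> \1%VF ->
    [set w l | l in open_chamber] `&` open_chamber = set0
}.

(* The contragredient action: (w . x) is the unique y with
   l y = (w^-1 l) x for all l in the dual space. *)
Definition dual_act (w : 'End(dualV)) (x : V) : V :=
  xget 0 [set y | forall l : dualV, l y = (w^-1)%VF l x].

Definition group_image (G : set 'End(dualV)) (S : set V) : set V :=
  \bigcup_(w in G) (dual_act w @` S).

Definition face_orbit (F : set V) : set (set V) :=
  [set dual_act w @` F | w in coxeter_group].

Variables (h : 'I_n -> V) (alpha : 'I_n -> dualV).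

Definition cartan (i j : 'I_n) : R := alpha j (h i).

Definition cone_ge0 (J : {set 'I_n}) : set V :=
  [set \sum_(j in J) c j *: h j |
     c in [set c : 'I_n -> R | forall j, j \in J -> 0 <= c j]].

Definition cone_gt0 (J : {set 'I_n}) : set V :=
  [set \sum_(j in J) c j *: h j |
     c in [set c : 'I_n -> R | forall j, j \in J -> 0 < c j]].

Definition facial (J : {set 'I_n}) : Prop :=
  face (cone_ge0 [set: 'I_n]) (cone_ge0 J).

Definition separated_sets (J J' : {set 'I_n}) : Prop :=
  forall j k, j \in J -> k \in J' -> cartan j k = 0.

Definition connected_set (J : {set 'I_n}) : Prop :=
  J != finset.set0 /\
  ~ exists J1 J2 : {set 'I_n},
      [/\ J1 != finset.set0, J2 != finset.set0, (J1 :&: J2 = finset.set0)%SET,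
          J = J1 :|: J2 & separated_sets J1 J2].

Definition component_of (J C : {set 'I_n}) : Prop :=
  [/\ C \subset J, connected_set C &
      forall D : {set 'I_n},
        D \subset J -> connected_set D -> C \subset D -> D = C].

Definition finite_type (J : {set 'I_n}) : Prop :=
  exists u : 'I_n -> R, (forall i, i \in J -> 0 < u i) /\
    (forall i, i \in J -> 0 < \sum_(j in J) cartan i j * u j).

Definition special (J : {set 'I_n}) : Prop :=
  forall C, component_of J C -> ~ finite_type C.

Definition special_facial (J : {set 'I_n}) : Prop := special J /\ facial J.

Definition dual_chamber : set V := [set x | forall i, 0 <= (alpha i x : R)].

Definition coneK : set V := cone_ge0 [set: 'I_n] `&` oppset dual_chamber.

Definition imaginary_cone : set V := group_image coxeter_group coneK.

Definition K_open (T : {set 'I_n}) : set V :=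
  cone_gt0 T `&` oppset dual_chamber.

Definition K_closed (T : {set 'I_n}) : set V :=
  cone_ge0 T `&` oppset dual_chamber.

Definition special_face (T : {set 'I_n}) : set V :=
  group_image (coxeter_subgroup T) (K_closed T).

End LinearCoxeterSystem.

(* Main.v *)
(* Positive roots: the reflections [w s_i w^-1] move the open chamber off itself, so
   no [w h_i] can vanish on it, whence every [w h_i] lies in the cone [Q] generated by
   the [h_i] or in [-Q]. This yields the exchange condition, hence [w x - x] in [Q] for
   antidominant [x] and the fact that a point with finitely many inversions can be
   moved into the antidominant chamber; in particular [Z] is a convex cone in [Q].
   For facial [T] the set [F(T)] is the intersection of [Z] with the cone on
   the [h_i], [i] in [T], hence a face of [Z], and [K] is the disjoint union of the [K(T)].

   The main point is that each [x] in [K(T)] is a relative interior point of [F(T)].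
   Otherwise let [N] be the nonzero cone of functionals which are nonnegative on
   [F(T)] and vanish at [x]; it is stable under the stabilizer of [x]. Take [x1] in
   [K(T)] and in the relative interior of [F(T)]. Among the tuples in [N] that are
   bases of the span of [N] of determinant 1 or -1, one minimizes the sum of the values
   at [x1]; the sum [l] of that tuple satisfies [l (s_j x1) >= l x1] whenever [s_j]
   fixes [x], i.e. [l (h_j) >= 0] if moreover [alpha_j x1 < 0]. This makes [l] vanish
   at [x1], hence on [F(T)], a contradiction. *)

From HB Require Import structures.
Require Import Defs.
From mathcomp Require Import all_boot all_order all_algebra.
From mathcomp Require Import all_classical all_reals all_analysis.
From mathcomp Require Import perm finmap ring lra.

Set Implicit Arguments.
Unset Strict Implicit.
Unset Printing Implicit Defensive.

Import Order.TTheory GRing.Theory Num.Theory.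
Import numFieldNormedType.Exports.
Import VectorInternalTheory.

Local Open Scope classical_set_scope.
Local Open Scope ring_scope.

(** * Theorems of the alternative *)

(** For cones containing 0 the topological [ri] is traded for an algebraic condition, [core]: a
    small multiple of any point of the cone can be subtracted. Two obstacles shape the rest. The
    [h_i] may be linearly dependent, so points of [Q] have no canonical coefficients; facial sets
    replace supports, and functionals vanishing at a single [h_i] replace coordinates. And averaging
    a functional over the stabilizer of [x] would need finiteness of its action. Minimizing at [x1]
    over single elements of the cone [N] only yields 0, so a normalization is required; a norm need
    not be preserved by the stabilizer, whereas the determinant of a basis is, up to sign. Sublevel
    sets are compact because [x1] is interior. Minimality gives no invariant functional, only an
    inequality at [x1] for each reflection fixing [x]. This suffices when [x1] is generic: the
    indices with [alpha_j x1 = 0], on which it is silent, contribute to [x - e x1] a part that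
    already lies in [F(T)]. *)

Section Farkas.
Variable R : realType.

(** Induction on the number of forms. If the last form cannot be dropped, a point [x] violating [b]
    satisfies all the others and has [f n x < 0]; everything is then projected along [x] onto the
    kernel of [f n]. The module [U] is general because both the dual of [V] and a space of functions
    occur. *)
Lemma farkas_forms (U : lmodType R) (n : nat) (f : nat -> U -> R) (b : U -> R) :
  (forall i, scalar (f i)) -> scalar b ->
  (forall u, (forall i, (i < n)%N -> 0 <= f i u) -> 0 <= b u) ->
  exists c : nat -> R,
    (forall i, 0 <= c i) /\ forall u, b u = \sum_(i < n) c i * f i u.
Proof.
elim: n f b => [|n IHn] f b flin blin fb.
  exists (fun=> 0); split=> // u; rewrite big_ord0.
  have bN : b (- u) = - b u.
    have b0 : b 0 = 0.
      have := blin (-1) 0 0; rewrite scaler0 addr0 => {1}->; ring.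
    by have := blin (-1) u 0; rewrite addr0 b0 scaleN1r => ->; ring.
  have := fb u; have := fb (- u); rewrite bN => h1 h2.
  have {}h1 := h1 (fun i => ltac:(done)); have {}h2 := h2 (fun i => ltac:(done)).
  lra.
have [fbn|/existsNP[x /not_implyP[fx bx]]] :=
    pselect (forall u, (forall i, (i < n)%N -> 0 <= f i u) -> 0 <= b u).
  have [c [c0 bE]] := IHn f b flin blin fbn.
  exists (fun i => if i == n then 0 else c i); split=> [i|u].
    by case: ifP.
  rewrite big_ord_recr /= eqxx mul0r addr0 bE; apply: eq_bigr => i _.
  by rewrite ltn_eqF.
move/negP: bx; rewrite -ltNge => bx.
have tx : f n x < 0.
  rewrite ltNge; apply/negP => fnx; suff : 0 <= b x by rewrite leNgt bx.
  by apply: fb => i; rewrite ltnS leq_eqVlt => /orP[/eqP->//|]; exact: fx.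
set t := f n x in tx *.
have t0 : t != 0 by rewrite lt_eqF.
have lin_sub g k : scalar g -> scalar (fun u => g u - k * f n u).
  by move=> glin a u v; rewrite glin flin; ring.
have lin_at g u k : scalar g -> g (u - k *: x) = g u - k * g x.
  move=> glin; have -> : u - k *: x = (- k) *: x + u by rewrite scaleNr addrC.
  by rewrite glin; ring.
have fb' u : (forall i, (i < n)%N -> 0 <= f i u - f i x / t * f n u) ->
    0 <= b u - b x / t * f n u.
  move=> fu; have -> : b u - b x / t * f n u = b (u - (f n u / t) *: x).
    by rewrite lin_at //; field.
  apply: fb => i; rewrite lin_at // ltnS leq_eqVlt => /orP[/eqP->|/fu].
    by rewrite -/t divfK // subrr.
  by congr (0 <= _ - _); field.
have [c [c0 bE]] := IHn (fun i u => f i u - f i x / t * f n u)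
    (fun u => b u - b x / t * f n u) (fun i => lin_sub _ _ (flin i))
    (lin_sub _ _ blin) fb'.
(* The weight of [f n] after undoing the projection; nonnegative, since [b x] and [t] are negative
   and the other [f i x] are not. *)
pose k := b x / t - \sum_(i < n) c i * (f i x / t).
exists (fun i => if i == n then k else c i); split=> [i|u].
  case: ifP => // _; rewrite subr_ge0; apply: (@le_trans _ _ 0).
    apply: sumr_le0 => j _; apply: mulr_ge0_le0 => //.
    by apply: mulr_ge0_le0; [exact: fx|rewrite invr_le0 ltW].
  by apply: mulr_le0; [exact: ltW|rewrite invr_le0 ltW].
rewrite big_ord_recr /= eqxx.
have /= /eqP := bE u; rewrite subr_eq => /eqP ->.
under eq_bigr do rewrite mulrBr.
rewrite big_split /= sumrN /k mulrBl mulr_suml.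
under [X in _ = X + _]eq_bigr do rewrite ltn_eqF //.
have -> : \sum_(i < n) c i * (f i x / t * f n u)
   = \sum_(i < n) c i * (f i x / t) * f n u by apply: eq_bigr => i _; ring.
by ring.
Qed.

Variable V : vectType R.

Lemma lfun_separates (x : V) : (forall l : 'Hom(V, R^o), l x = 0) -> x = 0.
Proof.
move=> lx; rewrite (coord_vbasis (memvf x)) big1 // => i _.
have := lx (linfun (coord (vbasis fullv) i : V -> R^o)).
by rewrite lfunE /= => ->; rewrite scale0r.
Qed.

Lemma farkas (s : seq V) (x : V) :
  (exists2 c : nat -> R, (forall i, 0 <= c i) &
     x = \sum_(i < size s) c i *: s`_i) \/
  exists2 l : 'Hom(V, R^o), (forall y, y \in s -> 0 <= (l y : R)) & (l x : R) < 0.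
Proof.
have [fb|/existsNP[l /not_implyP[lf lx]]] := pselect (forall l : 'Hom(V, R^o),
    (forall i, (i < size s)%N -> 0 <= (l s`_i : R)) -> 0 <= (l x : R)); last first.
  right; exists l; last by rewrite ltNge; exact/negP.
  by move=> y /(nthP 0)[i lti <-]; exact: lf.
left.
have ev_lin (v : V) : scalar (fun l : 'Hom(V, R^o) => l v : R).
  by move=> a l m; rewrite add_lfunE scale_lfunE.
have [c [c0 xE]] := farkas_forms (fun i => ev_lin s`_i) (ev_lin x) fb.
exists c => //; apply/eqP; rewrite -subr_eq0; apply/eqP; apply: lfun_separates => l.
rewrite linearB linear_sum /= xE; apply/eqP; rewrite subr_eq0; apply/eqP.
by apply: eq_bigr => i _; rewrite linearZ.
Qed.

End Farkas.

Lemma farkas_forms_fin (R : realType) (U : lmodType R) (I : finType)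
    (f : I -> U -> R) (b : U -> R) :
  (forall i, scalar (f i)) -> scalar b ->
  (forall u, (forall i, 0 <= f i u) -> 0 <= b u) ->
  exists2 c : I -> R, forall i, 0 <= c i & forall u, b u = \sum_i c i * f i u.
Proof.
move=> flin blin fb.
pose f' m : U -> R := nth (fun=> 0) [seq f i | i <- enum I] m.
have f'E i : f' (enum_rank i) = f i.
  by rewrite /f' (nth_map i) ?nth_enum_rank // -cardE ltn_ord.
have f'lin m : scalar (f' m).
  have [mI|mI] := ltnP m #|I|.
    by rewrite -[m]/(val (Ordinal mI)) -[Ordinal mI]enum_valK f'E; exact: flin.
  rewrite /f' nth_default; last by rewrite size_map -cardE.
  by move=> a u v; rewrite mulr0 addr0.
have [|c [c0 bE]] := @farkas_forms R U #|I| f' b f'lin blin.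
  by move=> u fu; apply: fb => i; rewrite -f'E; apply: fu.
exists (fun i => c (enum_rank i)) => // u; rewrite bE.
rewrite (reindex (@enum_rank I)) /=; last first.
  by exists enum_val => i _; rewrite ?enum_rankK ?enum_valK.
by apply: eq_bigr => i _; rewrite f'E.
Qed.

(** Homogenized Farkas: [z.2] is a number [t] with [u i >= t] and [(a u) i >= t] on [U]. Either some
    solution has [t > 0], or the system forces [t <= 0] and the multipliers of the rows of [a] give
    [d]; unit vectors test the column sums, and [t = 1] excludes that [d] vanishes on [U]. *)
Lemma gordan (R : realType) (I : finType) (a : I -> I -> R) (U : {set I}) :
  (exists2 u : I -> R, forall i, i \in U -> 0 < u i &
     forall i, i \in U -> 0 < \sum_(k in U) a i k * u k) \/
  (exists2 d : I -> R, forall i, 0 <= d i & (exists2 i, i \in U & 0 < d i) /\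
     forall k, k \in U -> \sum_(i in U) d i * a i k <= 0).
Proof.
pose X : lmodType R := ((I -> R^o) * R^o)%type.
pose f (m : I + I) (z : X) : R := match m with
  | inl i => if i \in U then z.1 i - z.2 else 0
  | inr i => if i \in U then \sum_(k in U) a i k * z.1 k - z.2 else 0
  end.
have flin m : scalar (f m).
  move=> r y z; case: m => i /=; case: ifP => _; rewrite ?mulr0 ?addr0 //.
    change (r * y.1 i + z.1 i - (r * y.2 + z.2)
      = r * (y.1 i - y.2) + (z.1 i - z.2) :> R).
    by ring.
  change (\sum_(k in U) a i k * (r * y.1 k + z.1 k) - (r * y.2 + z.2)
    = r * (\sum_(k in U) a i k * y.1 k - y.2) + (\sum_(k in U) a i k * z.1 k - z.2) :> R).
  have -> : \sum_(k in U) a i k * (r * y.1 k + z.1 k) =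
      r * (\sum_(k in U) a i k * y.1 k) + \sum_(k in U) a i k * z.1 k.
    by rewrite mulr_sumr -big_split; apply: eq_bigr => k _ /=; ring.
  by ring.
have [fb|/existsNP[z /not_implyP[fz /negP]]] :=
  pselect (forall z : X, (forall m, 0 <= f m z) -> 0 <= - (z.2 : R)); last first.
  rewrite -ltNge oppr_lt0 => z2; left; exists (z.1 : I -> R) => i iU.
    by have := fz (inl i); rewrite /f iU subr_ge0; apply: lt_le_trans.
  by have := fz (inr i); rewrite /f iU subr_ge0; apply: lt_le_trans.
have blin : scalar (fun z : X => - (z.2 : R)).
  move=> r y z; change (- (r * y.2 + z.2) = r * - (y.2 : R) - (z.2 : R)); ring.
have [c c0 cE] := farkas_forms_fin flin blin fb.
have {}cE (z : X) : - (z.2 : R) = \sum_(i in U) c (inl i) * (z.1 i - z.2)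
    + \sum_(i in U) c (inr i) * (\sum_(k in U) a i k * z.1 k - z.2).
  rewrite [LHS]cE big_sumType /= [in RHS]big_mkcond [X in _ = _ + X]big_mkcond.
  by congr (_ + _); apply: eq_bigr => i _; rewrite /f; case: ifP => _; rewrite ?mulr0.
right; exists (fun i => c (inr i)) => //.
have colE k : k \in U -> c (inl k) + \sum_(i in U) c (inr i) * a i k = 0.
  move=> kU; have := cE ((fun i => (i == k)%:R : R^o), 0 : R^o).
  rewrite /= oppr0 => /esym; apply: etrans; congr (_ + _).
    rewrite (bigD1 k) //= eqxx addr0 mulr1 big1 ?addr0 // => i /andP[_ /negbTE->].
    by rewrite addr0 mulr0.
  apply: eq_bigr => i _; rewrite addr0; congr (_ * _).
  rewrite (bigD1 k) //= eqxx mulr1 big1 ?addr0 // => j /andP[_ /negbTE->].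
  by rewrite mulr0.
split; last first.
  by move=> k /colE/eqP; rewrite addrC addr_eq0 => /eqP->; rewrite oppr_le0.
apply: contrapT => no.
have d0 i : i \in U -> c (inr i) = 0.
  move=> iU; apply/eqP; rewrite eq_le c0 andbT leNgt; apply/negP => ci.
  by apply: no; exists i.
have e0 i : i \in U -> c (inl i) = 0.
  move=> iU; have := colE i iU; rewrite [X in _ + X]big1 ?addr0 // => k kU.
  by rewrite d0 ?mul0r.
have /= := cE ((fun=> 0 : R^o), 1 : R^o).
rewrite !big1 ?addr0 => [/eqP|i iU|i iU]; rewrite ?d0 ?e0 ?mul0r //.
by rewrite oppr_eq0 oner_eq0.
Qed.

(** * Relative interiors of convex cones *)

Section Cones.
Variables (R : realType) (V : vectType R).
Implicit Types (S : set V).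

Lemma exists_free_span S : exists (d : nat) (b : d.-tuple V),
  [/\ free b, forall i, S (tnth b i) & forall x, S x -> x \in <<b>>%VS].
Proof.
pose P d := `[< exists b : d.-tuple V, free b /\ forall i, S (tnth b i) >].
have exP : exists d, P d.
  exists 0%N; apply/asboolP; exists [tuple]; split; first exact: nil_free.
  by case.
have ubP d : P d -> (d <= \dim {:V})%N.
  move=> /asboolP[b [bfree _]].
  by rewrite -(size_tuple b) -(eqP bfree) dimvS // subvf.
case: (ex_maxnP exP ubP) => d /asboolP[b [bfree bS]] dmax.
exists d, b; split=> // x Sx; apply/negPn/negP => xb.
suff /dmax : P d.+1 by rewrite ltnn.
apply/asboolP; exists [tuple of x :: b]; split.
  by rewrite free_cons xb.
by move=> i; case: (unliftP ord0 i) => [j|] ->; rewrite ?tnthS ?tnth0.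
Qed.

Definition core S : set V :=
  [set x | S x /\ forall y, S y -> exists2 e : R, 0 < e & S (x - e *: y)].

Lemma cone_sum S (I : Type) (r : seq I) (P : pred I) (F : I -> V) :
  convex_cone S -> S 0 -> (forall i, P i -> S (F i)) ->
  S (\sum_(i <- r | P i) F i).
Proof. by move=> [SD _] S0 SF; elim/big_ind: _. Qed.

Lemma cone_scale S (c : R) x : convex_cone S -> S 0 -> 0 <= c -> S x -> S (c *: x).
Proof.
move=> [_ SZ] S0; rewrite le_eqVlt => /orP[/eqP<-|]; first by rewrite scale0r.
exact: SZ.
Qed.

Lemma core_le S x y (e e' : R) : convex_cone S -> S 0 -> S y -> 
  e' <= e -> S (x - e *: y) -> S (x - e' *: y).
Proof.
move=> Sc S0 Sy le Se; have -> : x - e' *: y = x - e *: y + (e - e') *: y.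
  by rewrite scalerBl addrA subrK.
by apply: Sc.1 => //; apply: cone_scale => //; rewrite subr_ge0.
Qed.

Lemma core_add S x y : convex_cone S -> core S x -> S y -> core S (x + y).
Proof.
move=> Sc [Sx xc] Sy; split; first exact: Sc.1.
move=> z /xc[e e0 Se]; exists e => //.
by rewrite addrAC; exact: Sc.1.
Qed.

Lemma core_uniform S x d (b : d.-tuple V) : convex_cone S -> S 0 ->
  core S x -> (forall i, S (tnth b i)) ->
  exists2 e : R, 0 < e & forall i, S (x - e *: tnth b i).
Proof.
move=> Sc S0 [Sx xc] bS.
have /choice[e eP] : forall i, exists e : R, 0 < e /\ S (x - e *: tnth b i).
  by move=> i; have [e] := xc _ (bS i); exists e.
pose m := \big[Order.min/1]_(i < d) e i.
exists m => [|i]; first by apply/bigmin_gtP; split=> // i _; have [] := eP i.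
by apply: (core_le (e := e i)) => //; [exact: bigmin_le_cond|have [] := eP i].
Qed.

End Cones.

(** * Continuity of sums, products and linear forms on row spaces *)

Section Continuity.
Variable R : realType.

Lemma continuous_sumr (T : topologicalType) (I : Type) (r : seq I)
    (F : I -> T -> R) :
  (forall i, continuous (F i)) -> continuous (fun u => \sum_(i <- r) F i u).
Proof.
move=> Fc u; elim: r => [|i r IHr].
  under eq_fun do rewrite big_nil; exact: cvg_cst.
by under eq_fun do rewrite big_cons; apply: cvgD => //; exact: Fc.
Qed.

Lemma continuous_prodr (T : topologicalType) (I : Type) (r : seq I)
    (F : I -> T -> R) :
  (forall i, continuous (F i)) -> continuous (fun u => \prod_(i <- r) F i u).
Proof.
move=> Fc u; elim: r => [|i r IHr].
  under eq_fun do rewrite big_nil; exact: cvg_cst.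
by under eq_fun do rewrite big_cons; apply: cvgM => //; exact: Fc.
Qed.

Lemma continuous_rowform m (f : 'rV[R]_m -> R) : scalar f -> continuous f.
Proof.
move=> flin.
pose F := GRing.isLinear.Build _ _ _ _ f flin.
pose fL : {scalar 'rV[R]_m} := HB.pack f F.
have -> : f = fun u => \sum_(j < m) u 0 j * f (delta_mx 0 j).
  apply/funext => u; rewrite [in LHS](row_sum_delta u).
  rewrite -[LHS]/(fL _) linear_sum; apply: eq_bigr => j _.
  by rewrite scalarZ.
apply: continuous_sumr => j u.
apply: (@continuousM R 'rV[R]_m (fun u => u 0 j) (fun=> f (delta_mx 0 j))).
  exact: coord_continuous.
exact: cst_continuous.
Qed.

Lemma closed_rowform_ge0 m (f : 'rV[R]_m -> R) :
  scalar f -> closed [set u | 0 <= f u].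
Proof.
move=> flin; apply: (@preimage_closed _ _ f [set x | 0 <= x]); last exact: closed_ge.
by move=> u _; exact: continuous_rowform.
Qed.

Lemma closed_rowform_eq0 m (f : 'rV[R]_m -> R) :
  scalar f -> closed [set u | f u = 0].
Proof.
move=> flin; apply: (@preimage_closed _ _ f [set x | x = 0]); last exact: closed_eq.
by move=> u _; exact: continuous_rowform.
Qed.

End Continuity.

Section RelativeInterior.
Variables (R : realType) (V : vectType R).
Implicit Types (S : set V).

Lemma ri_core S : convex_cone S -> S 0 -> ri S = core S.
Proof.
move=> Sc S0; apply/seteqP; split=> x [Sx xri]; split=> //.
  move=> y Sy.
  have : (fun e : R => v2r x - e *: v2r y) @ (0 : R) --> v2r x - 0 *: v2r y.
    apply: cvgB; first exact: cvg_cst.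
    by apply: cvgZr_tmp; exact: cvg_id.
  rewrite scale0r subr0 => /(_ _ xri) /nbhs_ballP[e /= e0 eP].
  exists (e / 2); first by rewrite divr_gt0.
  have := eP (e / 2); rewrite /= -linearZ -linearB v2rK; apply.
    by rewrite -ball_normE /= sub0r normrN ger0_norm; lra.
  (* The point 0 only corrects the sum of the affine weights. *)
  exists 3%N, (fun i => [:: 1; - (e / 2); e / 2]`_i), (fun i => [:: x; y; 0]`_i).
  split.
  - by move=> [[|[|[|]]]].
  - by rewrite !big_ord_recl big_ord0 /=; ring.
  - by rewrite !big_ord_recl big_ord0 /= scale1r scaleNr scaler0 !addr0.
have [d [b [bfree bS spanS]]] := exists_free_span S.
have [e e0 eP] := core_uniform Sc S0 (conj Sx xri) bS.
pose f i (u : 'rV[R]_(dim V)) : R := coord b i (r2v u).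
have fc i : continuous (f i).
  by apply: continuous_rowform => a u v; rewrite /f !linearP.
pose e' := e / d.+1%:R.
have e'0 : 0 < e' by rewrite divr_gt0.
have : \forall u \near nbhs (v2r x), forall i, `|f i (v2r x) - f i u| < e'.
  apply: filter_forall => i.
  by move/cvgrPdist_lt : (fc i (v2r x)); apply.
apply: filterS => u ue [m [t [p [pS t1 uE]]]].
have uU : r2v u \in <<b>>%VS.
  by rewrite uE; apply: memv_suml => i _; apply: memvZ; exact: spanS.
(* The mean of [x] and the [d] points [x - e b_i] falls short of [x] by [e'] times the sum of the
   [b_i]; this surplus absorbs the coordinate changes, which are smaller than [e']. *)
have -> : r2v u = (d.+1%:R^-1 *: x + \sum_(i < d) d.+1%:R^-1 *: (x - e *: tnth b i))
    + \sum_(i < d) (e' + (f i u - f i (v2r x))) *: tnth b i.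
  have -> : \sum_(i < d) (e' + (f i u - f i (v2r x))) *: tnth b i
     = \sum_(i < d) e' *: tnth b i + (r2v u - x).
    rewrite (coord_span uU) [X in _ + (_ - X)](coord_span (spanS _ Sx)).
    rewrite -sumrB -big_split /=; apply: eq_bigr => i _.
    by rewrite (tnth_nth 0) -scalerBl -scalerDl /f v2rK.
  have -> : \sum_(i < d) d.+1%:R^-1 *: (x - e *: tnth b i)
     = (d%:R / d.+1%:R) *: x - \sum_(i < d) e' *: tnth b i.
    under eq_bigr do rewrite scalerBr scalerA.
    rewrite sumrB sumr_const card_ord -scaler_nat scalerA; congr (_ - _).
    by apply: eq_bigr => i _; rewrite /e' mulrC.
  rewrite (addrA (_ *: x)) -scalerDl.
  have -> : d.+1%:R^-1 + d%:R / d.+1%:R = 1 :> R.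
    by rewrite -natr1; field; rewrite natr1.
  by rewrite scale1r addrA subrK addrC subrK.
apply: Sc.1; first apply: Sc.1.
- by apply: cone_scale => //; rewrite invr_ge0.
- by apply: cone_sum => // i _; apply: cone_scale => //; rewrite invr_ge0.
- apply: cone_sum => // i _; apply: cone_scale => //.
  by have := ue i; rewrite ltr_norml => /andP[]; lra.
Qed.

Lemma core_nonempty S : convex_cone S -> S 0 -> core S !=set0.
Proof.
move=> Sc S0; have [d [b [bfree bS spanS]]] := exists_free_span S.
exists (\sum_(i < d) tnth b i); split; first by apply: cone_sum => // i _.
move=> y Sy.
pose c i := coord b i y.
(* Chosen so that [e * c i <= 1] for every coordinate [c i] of [y], whatever its sign. *)
pose e := (1 + \sum_(i < d) `|c i|)^-1.
have s0 : 0 <= \sum_(i < d) `|c i| by exact: sumr_ge0.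
have e0 : 0 < e by rewrite invr_gt0; lra.
exists e => //.
rewrite (coord_span (spanS _ Sy)) scaler_sumr -sumrB; apply: cone_sum => // i _.
rewrite -(tnth_nth 0) scalerA -[X in X - _]scale1r -scalerBl.
apply: cone_scale => //; rewrite subr_ge0 -/(c i).
have ci : c i <= \sum_(i < d) `|c i|.
  rewrite (bigD1 i) //= (le_trans (ler_norm _)) // lerDl; exact: sumr_ge0.
by rewrite /e mulrC ler_pdivrMr; lra.
Qed.

(** [x] is the sum of [e y] and [x - e y]; were [e y] outside the face [G], so would be [x]. *)
Lemma core_face_sub (Z F G : set V) x :
  convex_cone F -> F `<=` Z -> face Z G -> core F x -> G x -> F `<=` G.
Proof.
move=> Fc FZ [Gc GZ Gface] [Fx xc] Gx y Fy; have [e e0 Fe] := xc y Fy.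
have eyG : G (e *: y).
  apply: contrapT => eyNG; have [||_] := Gface (e *: y) (x - e *: y).
  - by split=> //; apply: FZ; exact: Fc.2.
  - exact: FZ.
  - by rewrite addrC subrK.
have -> : y = e^-1 *: (e *: y) by rewrite scalerA mulVf ?scale1r // gt_eqF.
by apply: Gc.2 => //; rewrite invr_gt0.
Qed.

Lemma core_face_eq (Z F G : set V) x :
  face Z F -> face Z G -> core F x -> core G x -> F = G.
Proof.
move=> Ff Gf xF xG; have [Fc FZ _] := Ff; have [Gc GZ _] := Gf.
apply/seteqP; split; first exact: core_face_sub Fc FZ Gf xF xG.1.
exact: core_face_sub Gc GZ Ff xG xF.1.
Qed.

Lemma Fa_0 (Z F : set V) : Z 0 -> Fa Z F -> F 0.
Proof.
move=> Z0 [[_ FZ Fface] [y Fy]]; apply: contrapT => F0.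
by have [||_] := Fface 0 y; [split|exact: FZ|rewrite add0r].
Qed.

End RelativeInterior.

(** * A supporting functional adapted to a group of involutions *)

Section SupportingFunctional.
Variables (R : realType) (V : vectType R) (S : set V) (x x1 : V).
Hypotheses (Scone : convex_cone S) (S0 : S 0) (Sx : S x).
Hypotheses (x1core : core S x1) (xNcore : ~ core S x).
Variables (d : nat) (b : d.-tuple V).
Hypotheses (bfree : free b) (bS : forall i, S (tnth b i)).
Hypothesis spanS : forall y, S y -> y \in <<b>>%VS.

(** A functional is recorded by its values on the basis [b], which puts the normal cone into a row
    space, where compactness is available. Off the span of [b] this is merely some linear
    extension. *)
Definition form (r : 'rV[R]_d) (y : V) : R := \sum_(i < d) r 0 i * coord b i y.

Lemma form_scalar_l y : scalar (form^~ y).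
Proof.
move=> a r s; rewrite /form mulr_sumr -big_split /=; apply: eq_bigr => i _.
by rewrite !mxE; ring.
Qed.

Lemma form_scalar_r r : scalar (form r).
Proof.
move=> a y z; rewrite /form mulr_sumr -big_split /=; apply: eq_bigr => i _.
by rewrite linearP /=; ring.
Qed.

HB.instance Definition _ r := GRing.isLinear.Build _ _ _ _ (form r) (form_scalar_r r).

Lemma form_suml (I : Type) (r : seq I) (a : I -> R) (s : I -> 'rV[R]_d) y :
  form (\sum_(i <- r) a i *: s i) y = \sum_(i <- r) a i * form (s i) y.
Proof.
elim: r => [|i r IHr]; first by rewrite !big_nil /form big1 // => i _; rewrite mxE mul0r.
by rewrite !big_cons form_scalar_l IHr.
Qed.

Lemma form_basis r i : form r (tnth b i) = r 0 i.
Proof.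
rewrite /form (bigD1 i) //= big1 ?addr0 => [|j ji]; rewrite (tnth_nth 0) coord_free //.
  by rewrite eqxx mulr1.
by rewrite eq_sym (negbTE ji) mulr0.
Qed.

Lemma form_restrict (l : 'Hom(V, R^o)) y : S y ->
  form (\row_i l (tnth b i)) y = l y.
Proof.
move=> /spanS yb; rewrite [in RHS](coord_span yb) linear_sum; apply: eq_bigr => i _.
by rewrite mxE linearZ /= mulrC (tnth_nth 0).
Qed.

Definition normals : set 'rV[R]_d :=
  [set r | (forall y, S y -> 0 <= form r y) /\ form r x = 0].

Lemma closed_all (T : topologicalType) (I : Type) (P : I -> Prop) (F : I -> set T) :
  (forall i, P i -> closed (F i)) -> closed [set u | forall i, P i -> F i u].
Proof. exact: closed_bigI. Qed.

(** [S] may be neither closed nor finitely generated, so Farkas is applied to finite subsets of [S]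
    together with [- x], and compactness of the unit sphere yields a common functional.
    Nonnegativity at [x] and [- x] gives vanishing at [x]. *)
Lemma normals_nontrivial : exists2 r, normals r & r != 0.
Proof.
have [y0 Sy0 xy0] : exists2 y, S y & forall e : R, 0 < e -> ~ S (x - e *: y).
  apply: contrapT => no; apply: xNcore; split=> // y Sy; apply: contrapT => ne.
  by apply: no; exists y => // e e0 Se; apply: ne; exists e.
pose D : set V := S `|` [set - x].
pose sphere : set 'rV[R]_d := [set r | `|r| = 1].
have sphere_compact : compact sphere.
  apply: bounded_closed_compact.
    by exists 1; split; [exact: num_real|move=> M M1 r /= ->; exact: ltW].
  apply: (@preimage_closed _ _ (fun r : 'rV[R]_d => `|r|) [set a : R | a = 1]).
    by move=> r _; exact: norm_continuous.
  exact: closed_eq.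
have [r [rD r1]] : exists r : 'rV[R]_d, (forall y, D y -> 0 <= form r y) /\ `|r| = 1.
  suff [r rP] : \bigcap_(y in D) (sphere `&` [set r | 0 <= form r y]) !=set0.
    by exists r; split=> [y /rP[]//|]; case: (rP 0 (or_introl S0)).
  move: sphere_compact; rewrite compact_In0 /=; apply.
    exists (fun y => [set r | 0 <= form r y]) => // y _.
    by apply: closed_rowform_ge0; exact: form_scalar_l.
  move=> D' DD'.
  have D's y : y \in enum_fset D' -> D y by move=> /DD' /set_mem.
  have [[c c0 yE]|[l lD ly]] := farkas (enum_fset D') (- y0).
    (* The cone generated by [S] and [- x]. It misses [- y0]: from [- y0 = z - t x] it would follow
       that [x - t^-1 y0], or [x - y0] if [t = 0], is in [S]. *)
    pose T : set V := [set v | exists2 z, S z & exists2 t : R, 0 <= t & v = z - t *: x].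
    have Tcone : convex_cone T.
      split=> [v w [z Sz [t t0 ->]] [z' Sz' [t' t'0 ->]]|k v k0 [z Sz [t t0 ->]]].
        exists (z + z'); first exact: Scone.1.
        by exists (t + t'); [exact: addr_ge0|rewrite scalerDl opprD addrACA].
      exists (k *: z); first exact: Scone.2.
      by exists (k * t); [rewrite mulr_ge0 // ltW|rewrite scalerBr scalerA].
    have T0 : T 0 by exists 0 => //; exists 0 => //; rewrite scale0r subr0.
    have DT v : D v -> T v.
      move=> [Sv|->]; first by exists v => //; exists 0 => //; rewrite scale0r subr0.
      by exists 0 => //; exists 1 => //; rewrite sub0r scale1r.
    have [z Sz [t t0 yzt]] : T (- y0).
      rewrite yE; apply: cone_sum => // i _; apply: cone_scale => //; apply: DT.
      by apply: D's; exact: mem_nth.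
    move: t0; rewrite le_eqVlt => /orP[/eqP t0|t0].
      case: (xy0 1) => //; rewrite scale1r yzt -t0 scale0r subr0; exact: Scone.1.
    case: (xy0 t^-1); first by rewrite invr_gt0.
    have -> : x - t^-1 *: y0 = t^-1 *: z.
      rewrite -scalerN yzt scalerBr scalerA mulVf ?gt_eqF // scale1r.
      by rewrite addrC subrK.
    by apply: Scone.2 => //; rewrite invr_gt0.
  pose r : 'rV[R]_d := \row_i l (tnth b i).
  have rE y : D y -> form r y = l y.
    move=> [Sy|->]; first exact: form_restrict.
    rewrite [LHS]linearN [RHS]linearN; congr (- _).
    exact: form_restrict.
  have r0 : r != 0.
    apply/eqP => r0; move: ly; rewrite linearN /= -(form_restrict l Sy0) -/r r0.
    rewrite /form big1 ?oppr0 ?ltxx // => i _; by rewrite mxE mul0r.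
  have nr0 : 0 < `|r| by rewrite normr_gt0.
  exists (`|r|^-1 *: r) => y /= yD'; split.
    by rewrite /sphere /= normrZ normfV normr_id mulVf // gt_eqF.
  have -> : form (`|r|^-1 *: r) y = `|r|^-1 * form r y.
    by have := form_scalar_l y (`|r|^-1) r 0; rewrite addr0 => ->;
      rewrite [form 0 y]big1 ?addr0 // => i _; rewrite mxE mul0r.
  rewrite /= mulr_ge0 ?invr_ge0 // rE; last exact: D's.
  exact: lD.
exists r; last by rewrite -normr_gt0 r1.
split=> [y Sy|]; first by apply: rD; left.
apply/eqP; rewrite eq_le rD ?andbT; last by left.
by have := rD (- x) (or_intror erefl); rewrite [form _ _]linearN oppr_ge0.
Qed.

Lemma normals_sum (I : Type) (r : seq I) (F : I -> 'rV[R]_d) :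
  (forall i, normals (F i)) -> normals (\sum_(i <- r) F i).
Proof.
move=> FN.
have E y : form (\sum_(i <- r) F i) y = \sum_(i <- r) form (F i) y.
  under eq_bigr do rewrite -[F _]scale1r.
  by rewrite form_suml; apply: eq_bigr => i _; rewrite mul1r.
split=> [y Sy|]; rewrite E; first by apply: sumr_ge0 => i _; exact: (FN i).1.
by apply: big1 => i _; exact: (FN i).2.
Qed.

Section Pullback.
Variable g : 'End(V).
Hypotheses (gS : forall y, S y -> S (g y)) (gx : g x = x) (gg : (g \o g = \1)%VF).

Definition pullback (r : 'rV[R]_d) : 'rV[R]_d := \row_i form r (g (tnth b i)).

Lemma form_pullback r y : S y -> form (pullback r) y = form r (g y).
Proof.
move=> /spanS yb; rewrite [in RHS](coord_span yb) !linear_sum; apply: eq_bigr => i _.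
by rewrite mxE !linearZ /= mulrC (tnth_nth 0).
Qed.

Lemma pullback_normals r : normals r -> normals (pullback r).
Proof.
move=> [rS rx]; split=> [y Sy|]; rewrite form_pullback ?gx //.
by apply: rS; exact: gS.
Qed.

Lemma pullbackK r : pullback (pullback r) = r.
Proof.
apply/rowP => i; rewrite mxE form_pullback; last exact: gS.
by have /lfunP/(_ (tnth b i)) := gg; rewrite comp_lfunE id_lfunE => ->; exact: form_basis.
Qed.

Lemma pullback_sum (I : Type) (r : seq I) (a : I -> R) (s : I -> 'rV[R]_d) :
  pullback (\sum_(i <- r) a i *: s i) = \sum_(i <- r) a i *: pullback (s i).
Proof.
apply/rowP => j; rewrite mxE form_suml summxE; apply: eq_bigr => i _.
by rewrite !mxE.
Qed.

End Pullback.

Section Frames.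
Variables (m : nat) (s : m.-tuple 'rV[R]_d).
Hypotheses (sfree : free s) (sN : forall k, normals (tnth s k)).
Hypothesis spanN : forall r, normals r -> r \in << s >>%VS.

Definition frame_row (A : 'M[R]_m) (i : 'I_m) : 'rV[R]_d :=
  \sum_(k < m) A i k *: tnth s k.

(** Tuples of normals are given by their matrices in the basis [s], flattened to rows so that
    results on row vectors apply. Squaring the determinant covers both signs by one polynomial
    equation. *)
Definition frames : set 'rV[R]_(m * m) :=
  [set u | (forall i, normals (frame_row (vec_mx u) i)) /\ \det (vec_mx u) ^+ 2 = 1].

Definition frame_sum (u : 'rV[R]_(m * m)) : R :=
  \sum_(i < m) form (frame_row (vec_mx u) i) x1.

Lemma form_frame_row_scalar i y :
  scalar (fun u : 'rV[R]_(m * m) => form (frame_row (vec_mx u) i) y).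
Proof.
move=> a u v; rewrite !form_suml mulr_sumr -big_split /=; apply: eq_bigr => k _.
by rewrite !mxE; ring.
Qed.

Lemma frame_sum_scalar : scalar frame_sum.
Proof.
move=> a u v; rewrite /frame_sum mulr_sumr -big_split /=; apply: eq_bigr => i _.
exact: form_frame_row_scalar.
Qed.

Lemma frames_closed : closed frames.
Proof.
have -> : frames = [set u | forall i y, S y -> 0 <= form (frame_row (vec_mx u) i) y]
    `&` ([set u | forall i, True -> form (frame_row (vec_mx u) i) x = 0]
    `&` [set u | \det (vec_mx u) ^+ 2 = 1]).
  apply/seteqP; split=> u.
    by move=> [uN ud]; split=> [i y Sy|]; [exact: (uN i).1|split=> // i _; exact: (uN i).2].
  by move=> [u0 [ux ud]]; split=> // i; split; [exact: u0|exact: ux].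
apply: closedI.
  have -> : [set u | forall i y, S y -> 0 <= form (frame_row (vec_mx u) i) y]
    = [set u | forall i, True -> forall y, S y -> 0 <= form (frame_row (vec_mx u) i) y].
    by apply/seteqP; split=> u uP i; [move=> _|]; exact: uP.
  apply: (@closed_all _ _ (fun=> True)
    (fun i => [set u | forall y, S y -> 0 <= form (frame_row (vec_mx u) i) y])) => i _.
  apply: (@closed_all _ _ S (fun y => [set u | 0 <= form (frame_row (vec_mx u) i) y])) => y _.
  by apply: closed_rowform_ge0; exact: form_frame_row_scalar.
apply: closedI.
  apply: (@closed_all _ _ (fun=> True)
    (fun i => [set u | form (frame_row (vec_mx u) i) x = 0])) => i _.
  by apply: closed_rowform_eq0; exact: form_frame_row_scalar.
have detc : continuous (fun u : 'rV[R]_(m * m) => \det (vec_mx u)).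
  apply: (@continuous_sumr _ _ _ _ (fun (t : 'S_m) (u : 'rV[R]_(m * m)) =>
    (-1) ^+ t * \prod_i vec_mx u i (t i))) => t.
  have prodc : continuous (fun u : 'rV[R]_(m * m) => \prod_i vec_mx u i (t i)).
    apply: (@continuous_prodr _ _ _ _ (fun i (u : 'rV[R]_(m * m)) => vec_mx u i (t i))) => i.
    under eq_fun do rewrite mxE; exact: coord_continuous.
  move=> u; apply: (@continuousM R _ (fun=> (-1) ^+ t) _ u) (prodc u).
  exact: cst_continuous.
apply: (@preimage_closed _ _ (fun u : 'rV[R]_(m * m) => \det (vec_mx u) ^+ 2)
  [set a | a = 1]); last exact: closed_eq.
move=> u _; under eq_fun do rewrite expr2.
exact: (@continuousM R _ _ _ u (detc u) (detc u)).
Qed.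

(** Since [x1 - e b_l] lies in [S] for a small [e], a normal [r] has [r 0 l <= form r x1 / e]. A
    bound on the sum at [x1] therefore bounds all coordinates of all rows, hence the matrix. *)
Lemma frames_sublevel_compact c : compact (frames `&` [set u | frame_sum u <= c]).
Proof.
apply: bounded_closed_compact; last first.
  apply: closedI; first exact: frames_closed.
  apply: (@preimage_closed _ _ frame_sum [set a | a <= c]); last exact: closed_le.
  by move=> u _; apply: continuous_rowform; exact: frame_sum_scalar.
have [e e0 eP] := core_uniform Scone S0 x1core bS.
pose M := \sum_(k < m) \sum_(l < d) c / e * `|coord s k (delta_mx 0 l : 'rV[R]_d)|.
exists M; split=> [|y My u /= [[uN _] uc]]; first exact: num_real.
have N0 i y' : S y' -> 0 <= form (frame_row (vec_mx u) i) y' by exact: (uN i).1.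
have rowb i l : 0 <= frame_row (vec_mx u) i 0 l <= c / e.
  rewrite -form_basis N0 //= ler_pdivlMr //.
  have h1 : form (frame_row (vec_mx u) i) (x1 - e *: tnth b l) >= 0 by exact: N0.
  move: h1; rewrite linearB linearZ /= subr_ge0 mulrC => /le_trans; apply.
  apply: le_trans uc; rewrite /frame_sum (bigD1 i) //= lerDl.
  by apply: sumr_ge0 => j _; apply: N0; exact: x1core.1.
have entry i k : vec_mx u i k =
    \sum_(l < d) frame_row (vec_mx u) i 0 l * coord s k (delta_mx 0 l : 'rV[R]_d).
  transitivity (coord s k (frame_row (vec_mx u) i)).
    rewrite /frame_row linear_sum (bigD1 k) //= big1 => [|j jk]; rewrite linearZ /=.
      by rewrite (tnth_nth 0) coord_free // eqxx mulr1 addr0.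
    by rewrite (tnth_nth 0) coord_free // (negbTE jk) mulr0.
  rewrite {1}[frame_row _ i]row_sum_delta linear_sum; apply: eq_bigr => l _.
  by rewrite linearZ.
apply: le_trans (ltW My); rewrite [leLHS]/Num.norm /= mx_normrE.
(* The sign of [c] is not given; it is read off from an entry, hence the index bounds. *)
have pos k l : (l < d)%N -> (k < m)%N -> 0 <= c / e.
  move=> ld km; have /andP[] := rowb (Ordinal km) (Ordinal ld); exact: le_trans.
apply: bigmax_le => [|[z j] _] /=.
  apply: sumr_ge0 => k _; apply: sumr_ge0 => l _; apply: mulr_ge0 => //.
  by apply: (pos k l).
have [i [k ->]] : exists i k, j = mxvec_index i k by case/mxvec_indexP: j => i k; exists i, k.
rewrite (ord1 z); have -> : u 0 (mxvec_index i k) = vec_mx u i k by rewrite mxE.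
rewrite entry; apply: le_trans (ler_norm_sum _ _ _) _.
rewrite /M (bigD1 k) //= -[leLHS]addr0; apply: lerD.
  apply: ler_sum => l _; rewrite normrM; apply: ler_wpM2r => //.
  by have /andP[h1 h2] := rowb i l; rewrite ger0_norm.
apply: sumr_ge0 => k' _; apply: sumr_ge0 => l _; apply: mulr_ge0 => //.
by apply: (pos k l).
Qed.

Lemma frame_row_mul (A B : 'M[R]_m) i :
  frame_row (A *m B) i = \sum_(k < m) A i k *: frame_row B k.
Proof.
rewrite /frame_row; under [RHS]eq_bigr do rewrite scaler_sumr.
rewrite exchange_big /=; apply: eq_bigr => k _.
rewrite mxE scaler_suml; apply: eq_bigr => j _; by rewrite scalerA.
Qed.

Lemma frame_row_inj (A B : 'M[R]_m) : (forall i, frame_row A i = frame_row B i) -> A = B.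
Proof.
move=> AB; apply/matrixP => i k; apply/eqP; rewrite -subr_eq0; apply/eqP.
move/freeP: sfree => /(_ (fun k => A i k - B i k)) -> //.
under eq_bigr do rewrite scalerBl -tnth_nth.
by rewrite sumrB; apply/eqP; rewrite subr_eq0; apply/eqP; exact: AB.
Qed.

(** Pullback by [g] preserves the normals, so it acts on their span by a matrix [B]; pulling back
    twice is the identity, whence [B *m B = 1]. *)
Lemma pullback_matrix (g : 'End(V)) :
  (forall y, S y -> S (g y)) -> g x = x -> (g \o g = \1)%VF ->
  exists2 B : 'M[R]_m, forall k, frame_row B k = pullback g (tnth s k)
    & \det B ^+ 2 = 1.
Proof.
move=> gS gx gg.
pose B : 'M[R]_m := \matrix_(k, j) coord s j (pullback g (tnth s k)).
have BE k : frame_row B k = pullback g (tnth s k).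
  rewrite [RHS](coord_span (spanN (pullback_normals gS gx (sN k)))).
  by apply: eq_bigr => j _; rewrite mxE !(tnth_nth 0).
exists B => //; rewrite expr2 -det_mulmx.
suff -> : B *m B = 1%:M by rewrite det1.
apply: frame_row_inj => i; rewrite frame_row_mul.
under eq_bigr do rewrite BE.
rewrite -pullback_sum -[\sum_(_ < _) _]/(frame_row B i) BE pullbackK //.
rewrite /frame_row (bigD1 i) //= big1 => [|k ki]; rewrite mxE.
  by rewrite eqxx scale1r addr0.
by rewrite eq_sym (negbTE ki) scale0r.
Qed.

End Frames.

End SupportingFunctional.

(* An involution acts on the frames of the normal cone of [S] at [x] with determinant
   1 or -1, so that it cannot decrease the sum of a minimal unimodular frame. *)
Lemma invariant_support (R : realType) (V : vectType R) (S : set V) (x x1 : V) :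
  convex_cone S -> S 0 -> S x -> core S x1 -> ~ core S x ->
  exists l : 'Hom(V, R^o),
    [/\ forall y, S y -> 0 <= (l y : R), l x = 0, exists2 y, S y & l y != 0 &
      forall g : 'End(V), (forall y, S y -> S (g y)) -> g x = x ->
        (g \o g = \1)%VF -> (l x1 : R) <= l (g x1)].
Proof.
move=> Sc S0 Sx x1c xNc.
have [d [b [bfree bS spanS]]] := exists_free_span S.
have [m [s [sfree sN spanN]]] := exists_free_span (normals S x b).
have m0 : (0 < m)%N.
  have [r rN r0] := normals_nontrivial Sc S0 Sx xNc spanS.
  rewrite lt0n; apply/negP => /eqP m0; move: r0.
  rewrite (coord_span (spanN _ rN)) big1 ?eqxx // => i _.
  by have := ltn_ord i; rewrite {2}m0.
pose u0 := mxvec (1%:M : 'M[R]_m).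
have u0F : frames S x b s u0.
  rewrite /frames /= mxvecK; split=> [i|]; last by rewrite det1 expr1n.
  rewrite /frame_row (bigD1 i) //= big1 => [|k ki]; rewrite mxE.
    by rewrite eqxx scale1r addr0.
  by rewrite eq_sym (negbTE ki) scale0r.
have [|||u uE umin] := @EVT_min_rV R _ (frame_sum x1 b s)
    (frames S x b s `&` [set u | frame_sum x1 b s u <= frame_sum x1 b s u0]).
- by exists u0; split=> //=.
- exact: frames_sublevel_compact.
- by apply: continuous_subspaceT => ?; apply: continuous_rowform; exact: frame_sum_scalar.
move: uE => /set_mem[uF uu0].
have {}umin v : frames S x b s v -> frame_sum x1 b s u <= frame_sum x1 b s v.
  move=> vF; have [vu0|/ltW] := leP (frame_sum x1 b s v) (frame_sum x1 b s u0).
    by apply: umin; exact: mem_set.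
  exact: le_trans.
pose r := \sum_(i < m) frame_row s (vec_mx u) i.
have [uN udet] := uF.
have rN : normals S x b r by exact: normals_sum.
have rE y : form b r y = \sum_(i < m) form b (frame_row s (vec_mx u) i) y.
  rewrite /r; under eq_bigr do rewrite -[frame_row _ _ _]scale1r.
  by rewrite form_suml; apply: eq_bigr => i _; rewrite mul1r.
have r0 : r != 0.
  apply/eqP => r0.
  have : (const_mx 1 : 'rV[R]_m) *m vec_mx u = 0.
    apply/rowP => k; rewrite [RHS]mxE.
    have : free s by []. move/freeP => /(_ (fun k => (const_mx 1 *m vec_mx u) (0 : 'I_1) k)).
    apply; rewrite -[RHS]r0 /r /frame_row exchange_big /=; apply: eq_bigr => j _.
    by rewrite mxE scaler_suml (tnth_nth 0); apply: eq_bigr => i _; rewrite mxE mul1r.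
  have uu : vec_mx u \in unitmx.
    rewrite unitmxE unitfE; apply/eqP => u0'; move: udet; rewrite u0' expr0n /= => /esym/eqP.
    by rewrite oner_eq0.
  move/(congr1 (mulmx^~ (invmx (vec_mx u)))); rewrite mulmxK // mul0mx => /rowP/(_ (Ordinal m0)).
  by rewrite !mxE => /eqP; rewrite oner_eq0.
exists (linfun (form b r : V -> R^o)); split.
- by move=> y Sy; rewrite lfunE /=; exact: rN.1.
- by rewrite lfunE /=; exact: rN.2.
- have /rV0Pn[i ri] := r0; exists (tnth b i) => //.
  by rewrite lfunE /= form_basis.
move=> g gS gx gg; rewrite !lfunE /= !rE.
have [B BE Bdet] := pullback_matrix Sx bfree bS spanS sfree sN spanN gS gx gg.
pose A : 'M[R]_m := vec_mx u.
have rowAB i : frame_row s (A *m B) i = pullback b g (frame_row s A i).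
  rewrite frame_row_mul; under eq_bigr do rewrite BE.
  by rewrite -pullback_sum.
have ABF : frames S x b s (mxvec (A *m B)).
  rewrite /frames /= mxvecK; split=> [i|]; last by rewrite det_mulmx exprMn udet Bdet mul1r.
  by rewrite rowAB; exact: pullback_normals.
apply: le_trans (umin _ ABF) _; rewrite /frame_sum mxvecK le_eqVlt; apply/orP; left.
by apply/eqP; apply: eq_bigr => i _; rewrite rowAB (form_pullback spanS) //; exact: x1c.1.
Qed.

(** * Reflection groups and their orbit cone *)

Lemma exists_small (R : realType) (I : finType) (P : pred I) (a b : I -> R) :
  (forall i, P i -> 0 < a i) ->
  exists2 e : R, 0 < e & forall i, P i -> e * b i < a i.
Proof.
move=> a0; pose m := \big[Order.min/1]_(i | P i) (a i / (`|b i| + 1)).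
have b1 i : 0 < `|b i| + 1 by rewrite ltr_wpDl.
exists m => [|i Pi]; first by apply/bigmin_gtP; split=> // i Pi; rewrite divr_gt0 ?a0.
have m0 : 0 < m by apply/bigmin_gtP; split=> // j Pj; rewrite divr_gt0 ?a0.
apply: (@le_lt_trans _ _ (m * `|b i|)); first by rewrite ler_pM2l ?ler_norm.
apply: (@lt_le_trans _ _ (m * (`|b i| + 1))); first by rewrite ltr_pM2l // ltrDl.
by rewrite -ler_pdivlMr //; exact: bigmin_le_cond.
Qed.

Section LinearForms.
Variables (R : realType) (V : vectType R).
Implicit Types (l m : 'Hom(V, R^o)) (x y : V) (a : R).

(* The values are read in [R] rather than in the regular module [R^o]. *)
Lemma lf0 l : (l 0 : R) = 0. Proof. exact: linear0. Qed.
Lemma lfN l x : (l (- x) : R) = - (l x : R). Proof. exact: linearN. Qed.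
Lemma lfD l x y : (l (x + y) : R) = (l x : R) + (l y : R). Proof. exact: linearD. Qed.
Lemma lfB l x y : (l (x - y) : R) = (l x : R) - (l y : R). Proof. exact: linearB. Qed.
Lemma lfZ l a x : (l (a *: x) : R) = a * (l x : R). Proof. exact: linearZ. Qed.
Lemma lf_sum l (I : Type) (r : seq I) (P : pred I) (F : I -> V) :
  (l (\sum_(t <- r | P t) F t) : R) = \sum_(t <- r | P t) (l (F t) : R).
Proof. exact: linear_sum. Qed.
Lemma lf_add l m x : ((l + m) x : R) = (l x : R) + (m x : R). Proof. exact: add_lfunE. Qed.
Lemma lf_scale l a x : ((a *: l) x : R) = a * (l x : R). Proof. exact: scale_lfunE. Qed.

End LinearForms.

(** * Cones generated by the [h i] *)

Section SimplicialCones.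
Variables (R : realType) (V : vectType R) (n : nat) (h : 'I_n -> V).
Implicit Types (J T : {set 'I_n}) (i j k : 'I_n) (x y : V).

Lemma cone_ge0_convex J : convex_cone (cone_ge0 h J).
Proof.
split=> [x y [c /= c0 <-] [c' /= c'0 <-]|a x a0 [c /= c0 <-]].
  exists (fun j => c j + c' j) => /= [j jJ|]; first by rewrite addr_ge0 ?c0 ?c'0.
  by rewrite -big_split; apply: eq_bigr => j _; rewrite scalerDl.
exists (fun j => a * c j) => /= [j jJ|]; first by rewrite mulr_ge0 ?c0 // ltW.
by rewrite scaler_sumr; apply: eq_bigr => j _; rewrite scalerA.
Qed.

Lemma cone_ge0_0 J : cone_ge0 h J 0.
Proof. by exists (fun=> 0) => //=; rewrite big1 // => j _; rewrite scale0r. Qed.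

Lemma cone_ge0_gen J j : j \in J -> cone_ge0 h J (h j).
Proof.
move=> jJ; exists (fun k => (k == j)%:R) => /= [k _|]; first exact: ler0n.
rewrite (bigD1 j) //= eqxx scale1r big1 ?addr0 // => k /andP[_ /negbTE->].
by rewrite scale0r.
Qed.

Lemma cone_ge0_sum J (I : Type) (r : seq I) (P : pred I) (F : I -> V) :
  (forall t, P t -> cone_ge0 h J (F t)) -> cone_ge0 h J (\sum_(t <- r | P t) F t).
Proof. exact: cone_sum (cone_ge0_convex J) (cone_ge0_0 J). Qed.

Lemma cone_ge0_scale J (a : R) x : 0 <= a -> cone_ge0 h J x -> cone_ge0 h J (a *: x).
Proof. exact: cone_scale (cone_ge0_convex J) (cone_ge0_0 J). Qed.

Lemma cone_ge0_add J x y : cone_ge0 h J x -> cone_ge0 h J y -> cone_ge0 h J (x + y).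
Proof. exact: (cone_ge0_convex J).1. Qed.

Lemma cone_ge0_sub J J' x : J \subset J' -> cone_ge0 h J x -> cone_ge0 h J' x.
Proof.
move=> /fintype.subsetP JJ' [c /= c0 <-]; apply: cone_ge0_sum => j jJ.
by apply: cone_ge0_scale; [exact: c0|apply: cone_ge0_gen; exact: JJ'].
Qed.

Lemma cone_gt0_ge0 J x : cone_gt0 h J x -> cone_ge0 h J x.
Proof. by move=> [c /= c0 <-]; exists c => //= j /c0/ltW. Qed.

Lemma cone_gt0_add J x y : cone_gt0 h J x -> cone_ge0 h J y -> cone_gt0 h J (x + y).
Proof.
move=> [c /= c0 <-] [c' /= c'0 <-]; exists (fun j => c j + c' j) => /= [j jJ|].
  by rewrite ltr_wpDr ?c0 ?c'0.
by rewrite -big_split; apply: eq_bigr => j _; rewrite scalerDl.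
Qed.

Lemma cone_gt0_sub J x y : cone_gt0 h J x -> cone_ge0 h J y ->
  exists2 e : R, 0 < e & cone_gt0 h J (x - e *: y).
Proof.
move=> [c /= c0 <-] [c' /= c'0 <-].
have [e e0 eP] := exists_small c' c0; exists e => //.
exists (fun j => c j - e * c' j) => /= [j jJ|]; first by rewrite subr_gt0 eP.
by rewrite scaler_sumr -sumrB; apply: eq_bigr => j _; rewrite scalerBl scalerA.
Qed.

Lemma cone_ge0_lfun J (l : 'Hom(V, R^o)) x :
  (forall j, j \in J -> 0 <= (l (h j) : R)) -> cone_ge0 h J x -> 0 <= (l x : R).
Proof.
move=> l0 [c /= c0 <-]; rewrite lf_sum; apply: sumr_ge0 => j jJ.
by rewrite lfZ mulr_ge0 ?c0 ?l0.
Qed.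

Lemma cone_ge0_setT x : cone_ge0 h [set: 'I_n] x ->
  exists2 c : 'I_n -> R, forall i, 0 <= c i & x = \sum_i c i *: h i.
Proof.
move=> [c /= c0 <-]; exists c => [i|]; first by rewrite c0 ?inE.
by apply: eq_bigl => i; rewrite inE.
Qed.

Lemma farkas_cone x : ~ cone_ge0 h [set: 'I_n] x ->
  exists2 l : 'Hom(V, R^o), forall i, 0 <= (l (h i) : R) & (l x : R) < 0.
Proof.
move=> xQ; have [[c c0 xE]|[l ls lx]] := farkas [seq h i | i <- enum 'I_n] x.
  case: xQ; rewrite xE; apply: cone_ge0_sum => i _; apply: cone_ge0_scale => //.
  have /mapP[j _ ->] := mem_nth 0 (ltn_ord i).
  by apply: cone_ge0_gen; rewrite inE.
by exists l => // i; apply/ls/map_f; rewrite mem_enum.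
Qed.

End SimplicialCones.

Section ReflectionGroup.
Variables (R : realType) (V : vectType R) (n : nat).
Variables (h : 'I_n -> V) (alpha : 'I_n -> 'Hom(V, R^o)).
Implicit Types (J T : {set 'I_n}) (i j k : 'I_n) (x y z : V) (w u : seq 'I_n).

Definition refl i x : V := x - (alpha i x : R) *: h i.

Lemma refl_linear i : linear (refl i).
Proof.
move=> a x y; rewrite /refl lfD lfZ scalerBr scalerDl opprD addrACA scalerA.
by [].
Qed.

HB.instance Definition _ i := GRing.isLinear.Build _ _ _ _ (refl i) (refl_linear i).

(** Group elements are represented by words, with reversal as inverse; distinct words may act alike,
    so equality in the group becomes pointwise equality of actions. *)
Definition wact w x : V := foldr refl x w.

Lemma wact_linear w : linear (wact w).
Proof. by move=> a x y; elim: w => //= i w ->; rewrite linearP. Qed.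

HB.instance Definition _ w := GRing.isLinear.Build _ _ _ _ (wact w) (wact_linear w).

Lemma wact_cat w u x : wact (w ++ u) x = wact w (wact u x).
Proof. exact: foldr_cat. Qed.

Hypothesis alpha_h : forall i, alpha i (h i) = 2.

Lemma alpha_hR i : (alpha i (h i) : R) = 2. Proof. exact: alpha_h. Qed.

Lemma refl_h i : refl i (h i) = - h i.
Proof. by rewrite /refl alpha_hR scaler_nat mulr2n opprD addNKr. Qed.

Lemma alpha_refl i x : (alpha i (refl i x) : R) = - (alpha i x : R).
Proof. by rewrite /refl lfB lfZ alpha_hR; ring. Qed.

Lemma reflK i : involutive (refl i).
Proof. by move=> x; rewrite {1}/refl alpha_refl scaleNr opprK subrK. Qed.

Lemma wactK w : cancel (wact w) (wact (rev w)).
Proof.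
elim: w => // i w IHw x; rewrite rev_cons -cats1 wact_cat /= reflK; exact: IHw.
Qed.

Lemma wactVK w : cancel (wact (rev w)) (wact w).
Proof. by move=> x; rewrite -{1}[w]revK wactK. Qed.

Lemma wact_conj w i x :
  wact (w ++ i :: rev w) x = x - (alpha i (wact (rev w) x) : R) *: wact w (h i).
Proof. by rewrite wact_cat /= /refl linearB linearZ /= wactVK. Qed.

Lemma h_neq0 i : h i != 0.
Proof.
apply/eqP => hi; have := alpha_h i; rewrite hi lf0 => /esym/eqP.
by rewrite pnatr_eq0.
Qed.

Lemma wact_h_neq0 w i : wact w (h i) != 0.
Proof.
by apply: contra (h_neq0 i) => /eqP wh; rewrite -(wactK w (h i)) wh linear0.
Qed.

Local Notation Q := (cone_ge0 h [set: 'I_n]).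
Local Notation inC l := (forall i, 0 < (l (h i) : R)).

(** This and the next two are the geometry of the chamber: an interior point, a relative interior
    point of each facet, and triviality of every element that maps an interior point to an interior
    point. *)
Hypothesis chamber_inhabited : exists rho : 'Hom(V, R^o), inC rho.
Hypothesis facet_inhabited : forall i, exists2 l : 'Hom(V, R^o),
  l (h i) = 0 & forall j, j != i -> 0 < (l (h j) : R).
Hypothesis chamber_free : forall w (l : 'Hom(V, R^o)),
  inC l -> (forall i, 0 < (l (wact w (h i)) : R)) -> forall x, wact w x = x.

(** * Roots and the exchange condition *)

Lemma Q_gen i : Q (h i).
Proof. by apply: cone_ge0_gen; rewrite inE. Qed.

Lemma Q_pointed x : Q x -> Q (- x) -> x = 0.
Proof.
have [rho rho0] := chamber_inhabited.
move=> /cone_ge0_setT[c c0 ->] /(cone_ge0_lfun (fun j _ => ltW (rho0 j))).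
rewrite lfN lf_sum oppr_ge0 => le0.
have ge0 i : true -> 0 <= (rho (c i *: h i) : R).
  by rewrite lfZ mulr_ge0 ?c0 // ltW.
have /eqP : \sum_i (rho (c i *: h i) : R) = 0.
  by apply/eqP; rewrite eq_le le0 sumr_ge0.
rewrite psumr_eq0 // => /allP ci0; apply: big1 => i _.
have := ci0 i (mem_index_enum i).
by rewrite /= lfZ mulf_eq0 (gt_eqF (rho0 i)) orbF => /eqP->; rewrite scale0r.
Qed.

Lemma Q_strict_sep x : ~ Q x -> exists2 l : 'Hom(V, R^o), inC l & (l x : R) < 0.
Proof.
move=> /farkas_cone[l l0 lx]; have [rho rho0] := chamber_inhabited.
have [|e e0 /(_ tt isT) eP] := @exists_small R unit xpredT (fun=> - (l x : R))
  (fun=> rho x : R); first by move=> _ _; rewrite oppr_gt0.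
exists (l + e *: rho) => [i|]; rewrite lf_add lf_scale.
  by rewrite ltr_wpDl // mulr_gt0.
by rewrite -ltrBrDl sub0r.
Qed.

(* Otherwise the hyperplane orthogonal to [w h_i] would meet the open chamber,
   whose points on it are fixed by the reflection [w s_i w^-1]. *)
Lemma root_dichotomy w i : Q (wact w (h i)) \/ Q (- wact w (h i)).
Proof.
set v := wact w (h i); apply: contrapT => /not_orP[/Q_strict_sep[l1 l1C l1v]].
move=> /Q_strict_sep[l2 l2C]; rewrite lfN oppr_lt0 => l2v.
pose l := (l2 v : R) *: l1 + (- (l1 v : R)) *: l2.
have lE y : (l y : R) = (l2 v : R) * (l1 y : R) - (l1 v : R) * (l2 y : R).
  by rewrite lf_add !lf_scale /= mulNr.
have lC : inC l by move=> j; rewrite lE -mulNr addr_gt0 // mulr_gt0 // oppr_gt0.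
have lv : (l v : R) = 0 by rewrite lE; ring.
have /(chamber_free lC)/(_ v) : forall j, 0 < (l (wact (w ++ i :: rev w) (h j)) : R).
  by move=> j; rewrite wact_conj lfB lfZ lv mulr0 subr0.
rewrite wact_conj {2}/v wactK alpha_hR -/v => /eqP.
rewrite -subr_eq0 addrAC subrr sub0r oppr_eq0 scaler_eq0 pnatr_eq0 /=.
by rewrite (negbTE (wact_h_neq0 _ _)).
Qed.

(** The functional of the [i]-th facet is nonnegative on [Q] and vanishes at [c *: h i], hence at
    [x]; being positive at the other [h k], it leaves only the coefficient of [h i]. *)
Lemma h_extremal i x (c : R) : Q x -> Q (c *: h i - x) -> exists2 d : R, 0 <= d & x = d *: h i.
Proof.
have [l li lj] := facet_inhabited i.
have l0 j : 0 <= (l (h j) : R).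
  by have [->|/lj/ltW//] := eqVneq j i; rewrite li.
move=> /cone_ge0_setT[d d0 ->] /(cone_ge0_lfun (fun j _ => l0 j)).
rewrite lfB lfZ li mulr0 sub0r oppr_ge0 lf_sum => le0.
have ge0 k : true -> 0 <= (l (d k *: h k) : R) by rewrite lfZ mulr_ge0.
have /eqP : \sum_k (l (d k *: h k) : R) = 0.
  by apply/eqP; rewrite eq_le le0 sumr_ge0.
rewrite psumr_eq0 // => /allP dk0.
exists (d i) => //; rewrite (bigD1 i) //= big1 ?addr0 // => k ki.
have := dk0 k (mem_index_enum k).
by rewrite /= lfZ mulf_eq0 (gt_eqF (lj _ ki)) orbF => /eqP->; rewrite scale0r.
Qed.

Lemma h_independent i j (d : R) : h j = d *: h i -> j = i.
Proof.
move=> hj; apply/eqP; apply: contraT => ji; have [l li /(_ _ ji)] := facet_inhabited i.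
by rewrite hj lfZ li mulr0 ltxx.
Qed.

Lemma root_turns_negative i x : Q x -> Q (- refl i x) -> exists2 d : R, 0 <= d & x = d *: h i.
Proof. by move=> Qx; rewrite opprB => /(h_extremal Qx). Qed.

(* Near the i-th facet of the chamber the product of the two reflections
   is close to the identity, hence it is the identity. *)
Lemma root_refl w i j (c : R) : 0 < c -> wact w (h j) = c *: h i ->
  forall x, wact (w ++ j :: rev w) x = refl i x.
Proof.
move=> c0 whj x; apply: (can_inj (reflK i)); rewrite reflK.
have wE y : wact (i :: w ++ j :: rev w) y =
    y + (c * (alpha j (wact (rev w) y) : R) - (alpha i y : R)) *: h i.
  rewrite /= wact_conj whj scalerA mulrC linearB linearZ /= refl_h /refl scalerN.
  by rewrite opprK scalerBl addrAC addrA.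
rewrite -[LHS]/(wact (i :: w ++ j :: rev w) x).
have [l li lj] := facet_inhabited i; have [rho rho0] := chamber_inhabited.
pose g k : R := c * (alpha j (wact (rev w) (h k)) : R) - (alpha i (h k) : R).
have gi : g i = 0.
  have hj : wact (rev w) (h i) = c^-1 *: h j.
    by rewrite -[h j](wactK w) whj linearZ /= scalerA mulVf ?scale1r // gt_eqF.
  by rewrite /g hj lfZ !alpha_hR mulrA mulfV ?mul1r ?subrr // gt_eqF.
(* [g k] is the shift of [h k] along [h i]. As [l] vanishes at [h i], the shift costs only a
   multiple of [e], which the fixed value of [l] at [h k] outweighs for small [e]. *)
have [e e0 eP] := @exists_small R _ (fun k => k != i) (fun k => l (h k) : R)
  (fun k => - g k * (rho (h i) : R)) lj.
have lE y : ((l + e *: rho) y : R) = (l y : R) + e * (rho y : R).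
  by rewrite lf_add lf_scale.
have lC : inC (l + e *: rho).
  move=> k; rewrite lE; have [->|/lj lk] := eqVneq k i; first by rewrite li add0r mulr_gt0.
  by rewrite addr_gt0 // mulr_gt0.
apply: (chamber_free lC) => k.
rewrite wE lfD lfZ -/(g k) !lE li add0r.
have [->|ki] := eqVneq k i; first by rewrite gi mul0r addr0 li add0r mulr_gt0.
have := eP _ ki; have : 0 < e * (rho (h k) : R) by rewrite mulr_gt0.
set a := e * rho (h k); set b := e * rho (h i) => a0.
have -> : e * (- g k * (rho (h i) : R)) = - (g k * b) by rewrite /b; ring.
by rewrite -subr_gt0 opprK => lt0; rewrite addrAC addr_gt0.
Qed.

(** If the value were positive, [h j] minus a positive multiple of [h i] would lie in [Q] or [- Q];
    either way extremality makes [h i] and [h j] proportional. *)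
Lemma cartan_le0 i j : i != j -> (alpha i (h j) : R) <= 0.
Proof.
move=> ij; rewrite leNgt; apply/negP => a0.
have Qa : Q ((alpha i (h j) : R) *: h i) by apply: cone_ge0_scale (Q_gen i); exact: ltW.
have [/= Q1|/= Q2] := root_dichotomy [:: i] j.
  have [d _ /(congr1 (fun v => (alpha i (h j) : R)^-1 *: v))] : exists2 d : R, 0 <= d &
      (alpha i (h j) : R) *: h i = d *: h j.
    by apply: (@h_extremal _ _ 1) => //; rewrite scale1r.
  rewrite !scalerA mulVf ?gt_eqF // scale1r => /h_independent ji.
  by rewrite ji eqxx in ij.
have [d _ /h_independent ji] := root_turns_negative (Q_gen j) Q2.
by rewrite ji eqxx in ij.
Qed.

(** [refl i] fixes [h j], so by [root_refl] conjugating [refl j] by it gives [refl j] again; at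
    [h i] this equates [alpha j (h i)] with its negative. *)
Lemma cartan_eq0 i j : (alpha i (h j) : R) = 0 -> (alpha j (h i) : R) = 0.
Proof.
move=> aij; have rj : refl i (h j) = h j by rewrite /refl aij scale0r subr0.
have wj : wact [:: i] (h j) = 1 *: h j by rewrite /= rj scale1r.
have := root_refl ltr01 wj (h i); rewrite wact_conj wj scale1r /rev /= refl_h.
rewrite lfN scaleNr /refl => /addrI/eqP; rewrite -subr_eq0 opprK.
rewrite -scalerDl scaler_eq0 (negbTE (h_neq0 j)) orbF => /eqP aa.
by lra.
Qed.

(** If the first letter [i] turns the root negative, the root before it is a positive multiple of
    [h i]; by [root_refl], moving [refl j] to the left across the rest of the word produces
    [refl i], which cancels that letter. *)
Lemma exchange w j : Q (- wact w (h j)) ->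
  exists2 w', (size w').+1 = size w & forall x, wact w' x = wact w (refl j x).
Proof.
elim: w => [|i w IHw] /= Qw.
  by have := h_neq0 j; rewrite (Q_pointed (Q_gen j) Qw) eqxx.
have [Qj|/IHw[w' sw' w'E]] := root_dichotomy w j; last first.
  by exists (i :: w') => /= [|x]; rewrite ?sw' ?w'E.
have [d d0 wj] := root_turns_negative Qj Qw.
have d_gt0 : 0 < d.
  rewrite lt_def d0 andbT; apply: contra (wact_h_neq0 w j) => /eqP d00.
  by rewrite wj d00 scale0r.
exists w => // x; have := root_refl d_gt0 wj (wact w x).
by rewrite wact_cat /= wactK => ->; rewrite reflK.
Qed.

(** * Antidominant points and finiteness of inversions *)

Definition antidominant x := forall i, (alpha i x : R) <= 0.

(** A last letter [j] adds [- alpha j x] times the root [wact w (h j)], which is harmless if the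
    root is positive; otherwise [exchange] shortens the word. *)
Lemma wact_antidominant w x : antidominant x -> Q (wact w x - x).
Proof.
move=> xa; have [m] := ubnP (size w); elim: m w => // m IHm w.
case/lastP: w => [_|w j]; first by rewrite subrr; exact: cone_ge0_0.
rewrite size_rcons ltnS => sw; rewrite -cats1 wact_cat /=.
have [Qj|Qj] := root_dichotomy w j; last first.
  have [w' sw' <-] := exchange Qj; apply: IHm; rewrite -sw' in sw; exact: ltnW.
rewrite {1}/refl linearB linearZ /= addrAC -scaleNr; apply: cone_ge0_add.
  exact: IHm.
by apply: cone_ge0_scale => //; rewrite oppr_ge0.
Qed.

Lemma antidominant_unique w x : antidominant x -> antidominant (wact w x) -> wact w x = x.
Proof.
move=> xa wxa; apply/eqP; rewrite -subr_eq0; apply/eqP; apply: Q_pointed.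
  exact: wact_antidominant.
by have := wact_antidominant (rev w) wxa; rewrite wactK opprB.
Qed.

Lemma antidominant_root u j x : antidominant x -> Q (wact u (h j)) ->
  (alpha j (wact (rev u) x) : R) <= 0.
Proof.
move=> xa Qu; rewrite leNgt; apply/negP => a0.
have := wact_antidominant (u ++ j :: rev u) xa.
rewrite wact_conj addrAC subrr sub0r => QN.
have /ltW a'0 : 0 < (alpha j (wact (rev u) x) : R)^-1 by rewrite invr_gt0.
have := cone_ge0_scale a'0 QN; rewrite scalerN scalerA mulVf ?gt_eqF // scale1r => QN'.
by have := wact_h_neq0 u j; rewrite (Q_pointed Qu QN') eqxx.
Qed.

Definition inversions_in (L : seq (seq 'I_n)) z := forall u j,
  Q (wact u (h j)) -> 0 < (alpha j (wact (rev u) z) : R) ->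
  exists2 t, t \in L & wact t =1 wact (u ++ j :: rev u).

Lemma inversions_antidominant x : antidominant x -> inversions_in [::] x.
Proof. by move=> xa u j Qu; rewrite ltNge (antidominant_root xa Qu). Qed.

Lemma inversion_refl i u j z :
  Q (wact u (h j)) -> 0 < (alpha j (wact (rev u) (refl i z)) : R) ->
  Q (wact (i :: u) (h j)) \/
  (wact (u ++ j :: rev u) =1 refl i /\ (alpha i z : R) < 0).
Proof.
move=> Qu a0; have [Qi|Qi] := root_dichotomy (i :: u) j; [by left|right].
have [d d0 ud] := root_turns_negative Qu Qi.
have d_gt0 : 0 < d.
  rewrite lt_def d0 andbT; apply: contra (wact_h_neq0 u j) => /eqP d00.
  by rewrite ud d00 scale0r.
have ui := root_refl d_gt0 ud; split=> //.
have := ui (refl i z); rewrite wact_conj ud scalerA {4}/refl => /addrI/oppr_inj/eqP.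
rewrite -subr_eq0 -scalerBl scaler_eq0 (negbTE (h_neq0 i)) orbF subr_eq0 => /eqP ad.
by rewrite -oppr_gt0 -alpha_refl -ad mulr_gt0.
Qed.

Lemma wact_conj_cons i j t u x : wact t =1 wact ((i :: u) ++ j :: rev (i :: u)) ->
  wact (i :: rcons t i) x = wact (u ++ j :: rev u) x.
Proof.
move=> tE; rewrite /= -cats1 wact_cat tE /= rev_cons -cats1 !wact_cat /= wact_cat /=.
by rewrite !reflK.
Qed.

Lemma inversions_refl L i z :
  inversions_in L z -> exists L', inversions_in L' (refl i z).
Proof.
move=> Lz; exists ([:: i] :: [seq i :: rcons t i | t <- L]) => u j Qu a0.
have [Qi|[ui _]] := inversion_refl Qu a0; last first.
  by exists [:: i] => [|x]; rewrite ?mem_head // ui.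
have [||t tL tE] := Lz (i :: u) j => //; first by rewrite rev_cons -cats1 wact_cat.
exists (i :: rcons t i) => [|x]; first by rewrite inE map_f ?orbT.
exact: wact_conj_cons.
Qed.

(** [refl i] is itself an inversion of [z], so deleting its words shortens [L]; the others are
    conjugated by [i]. No deleted word is needed: [refl i] would have to send a positive root to its
    negative and also to a positive root. *)
Lemma inversions_descent L i z : inversions_in L z -> 0 < (alpha i z : R) ->
  exists2 L', (size L' < size L)%N & inversions_in L' (refl i z).
Proof.
move=> Lz az; exists [seq i :: rcons t i | t <- L & ~~ `[< wact t =1 refl i >]].
  rewrite size_map size_filter -(count_predC (fun t => ~~ `[< wact t =1 refl i >]) L).
  rewrite -[X in (X < _)%N]addn0 ltn_add2l -has_count; apply/hasP.
  have [||t tL tE] := Lz [::] i; [exact: Q_gen|exact: az|].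
  by exists t => //=; rewrite negbK; apply/asboolP.
move=> u j Qu a0; have [Qi|[_]] := inversion_refl Qu a0; last by rewrite ltNge ltW.
have [||t tL tE] := Lz (i :: u) j => //; first by rewrite rev_cons -cats1 wact_cat.
have tE' x : wact (i :: rcons t i) x = wact (u ++ j :: rev u) x.
  exact: wact_conj_cons.
exists (i :: rcons t i) => //; apply: map_f; rewrite mem_filter tL andbT.
apply/asboolPn => ti; have := tE' (wact u (h j)).
rewrite /= -cats1 wact_cat ti /= reflK wact_conj wactK alpha_hR => ui.
have Qn : Q (- wact u (h j)).
  by move: Qi; rewrite /= ui scaler_nat mulr2n opprD addNKr.
by have := wact_h_neq0 u j; rewrite (Q_pointed Qu Qn) eqxx.
Qed.

Lemma inversions_add L L' x y :
  inversions_in L x -> inversions_in L' y -> inversions_in (L ++ L') (x + y).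
Proof.
move=> Lx L'y u j Qu; rewrite linearD /= lfD => a0.
have [ax|ax] := ltP 0 (alpha j (wact (rev u) x) : R).
  by have [t tL tE] := Lx u j Qu ax; exists t => //; rewrite mem_cat tL.
have ay : 0 < (alpha j (wact (rev u) y) : R) by lra.
by have [t tL tE] := L'y u j Qu ay; exists t => //; rewrite mem_cat tL orbT.
Qed.

Lemma descent L J z : inversions_in L z -> exists2 w, all (mem J) w &
  forall j, j \in J -> (alpha j (wact w z) : R) <= 0.
Proof.
have [m] := ubnP (size L); elim: m L z => // m IHm L z sL Lz.
have [zJ|/existsNP[j /not_implyP[jJ /negP]]] :=
  pselect (forall j, j \in J -> (alpha j z : R) <= 0); first by exists [::].
rewrite -ltNge => /(inversions_descent Lz)[L' sL' L'z].
have [|w wJ wz] := IHm L' (refl j z) _ L'z; first exact: leq_trans sL' _.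
exists (rcons w j); first by rewrite all_rcons /= jJ.
by move=> k /wz; rewrite -cats1 wact_cat.
Qed.

(** * The imaginary cone in terms of words *)

Lemma antidominantE x : oppset (dual_chamber alpha) x <-> antidominant x.
Proof.
split=> [[y y0 <-] i|xa]; first by rewrite lfN oppr_le0.
by exists (- x); [move=> i /=; rewrite lfN oppr_ge0|rewrite opprK].
Qed.

Definition orbit_cone : set V := [set z | exists w, coneK h alpha (wact w z)].

Lemma orbit_cone_wact w z : orbit_cone z -> orbit_cone (wact w z).
Proof. by move=> [u uz]; exists (u ++ rev w); rewrite wact_cat wactK. Qed.

Lemma orbit_cone_Q z : orbit_cone z -> Q z.
Proof.
move=> [w [Qw /antidominantE wa]].
rewrite -(wactK w z) -[wact (rev w) _](subrK (wact w z)); apply: cone_ge0_add => //.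
exact: wact_antidominant.
Qed.

Lemma orbit_cone_inversions z : orbit_cone z -> exists L, inversions_in L z.
Proof.
move=> [w [_ /antidominantE]]; rewrite -{2}(wactK w z); move: (wact w z) (rev w) => x u xa.
elim: u => [|i u [L Lz]]; first by exists [::]; exact: inversions_antidominant.
exact: inversions_refl Lz.
Qed.

Lemma orbit_cone_0 : orbit_cone 0.
Proof.
exists [::]; split=> /=; first exact: cone_ge0_0.
by apply/antidominantE => i; rewrite lf0.
Qed.

(* A sum of points of the orbit cone has finitely many inversions, so that it can
   be moved into the antidominant chamber. *)
Lemma orbit_cone_convex : convex_cone orbit_cone.
Proof.
split=> [x y xZ yZ|c x c0 [w [Qw /antidominantE wa]]]; last first.
  exists w; rewrite linearZ /=; split; first by apply: cone_ge0_scale => //; exact: ltW.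
  by apply/antidominantE => i; rewrite lfZ pmulr_rle0.
have [L xL] := orbit_cone_inversions xZ; have [L' yL'] := orbit_cone_inversions yZ.
have [w _ wa] := descent [set: 'I_n]%SET (inversions_add xL yL').
exists w; split; last by apply/antidominantE => i; apply: wa; rewrite inE.
by rewrite linearD; apply: cone_ge0_add; apply/orbit_cone_Q/orbit_cone_wact.
Qed.

(** * Facial sets and their faces of the orbit cone *)

Section Facial.
Variable T : {set 'I_n}.
Hypothesis Tfacial : facial h T.

Lemma facial_absorb x y : Q x -> Q y -> cone_ge0 h T (x + y) -> cone_ge0 h T x.
Proof.
case: Tfacial => _ _ face Qx Qy xyT; apply: contrapT => xT.
by have [|] := face x y _ Qy.
Qed.

(** Letters from [T] change [x] by multiples of [h i] with [i] in [T], of either sign; the image is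
    a difference [p - q] of points of the cone of [T], and faciality absorbs [q]. *)
Lemma wact_parabolic w x : all (mem T) w -> cone_ge0 h T x -> Q (wact w x) ->
  cone_ge0 h T (wact w x).
Proof.
move=> wT xT; suff [p pT [q qT ->]] : exists2 p, cone_ge0 h T p &
    exists2 q, cone_ge0 h T q & wact w x = p - q.
  move=> Qpq; apply: (facial_absorb (y := q)) => //; last by rewrite subrK.
  exact: cone_ge0_sub (finset.subsetT _) qT.
elim: w wT => [_|i w IHw /= /andP[iT /IHw[p pT [q qT ->]]]] /=.
  by exists x => //; exists 0; [exact: cone_ge0_0|rewrite subr0].
rewrite /refl; have [a0|a0] := leP 0 (alpha i (p - q) : R).
  exists p => //; exists (q + (alpha i (p - q) : R) *: h i); last by rewrite opprD addrA.
  by apply: cone_ge0_add => //; apply: cone_ge0_scale => //; exact: cone_ge0_gen.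
exists (p - (alpha i (p - q) : R) *: h i); last by exists q => //; rewrite addrAC.
rewrite -scaleNr; apply: cone_ge0_add => //; apply: cone_ge0_scale; last exact: cone_ge0_gen.
by rewrite oppr_ge0 ltW.
Qed.

End Facial.

(** Hence, for points of this cone, antidominance only has to be achieved on [T], which letters from
    [T] can do. *)
Lemma cone_off T k x : cone_ge0 h T x -> k \notin T -> (alpha k x : R) <= 0.
Proof.
move=> [c /= c0 <-] kT; rewrite lf_sum; apply: sumr_le0 => j jT.
rewrite lfZ mulr_ge0_le0 ?c0 // cartan_le0 //.
by apply: contraNneq kT => ->.
Qed.

Definition parabolic_face T : set V :=
  [set z | exists2 w, all (mem T) w & K_closed h alpha T (wact w z)].

Lemma parabolic_faceE T z : facial h T ->
  parabolic_face T z <-> orbit_cone z /\ cone_ge0 h T z.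
Proof.
move=> Tf; split=> [[w wT [wzT wa]]|[zZ zT]].
  have zZ : orbit_cone z.
    by exists w; split=> //; exact: cone_ge0_sub (finset.subsetT _) wzT.
  split=> //; rewrite -(wactK w z); apply: wact_parabolic => //.
    by rewrite all_rev.
  by rewrite wactK; exact: orbit_cone_Q.
have [L Lz] := orbit_cone_inversions zZ; have [w wT wa] := descent T Lz.
have wzT : cone_ge0 h T (wact w z).
  by apply: wact_parabolic => //; apply/orbit_cone_Q/orbit_cone_wact.
exists w => //; split=> //; apply/antidominantE => k.
by have [/wa//|kT] := boolP (k \in T); exact: cone_off wzT kT.
Qed.

Lemma parabolic_face_wact T w z : facial h T -> all (mem T) w ->
  parabolic_face T z -> parabolic_face T (wact w z).
Proof.
move=> Tf wT [u uT uz]; exists (u ++ rev w); first by rewrite all_cat uT all_rev.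
by rewrite wact_cat wactK.
Qed.

Lemma parabolic_face_face T : facial h T -> face orbit_cone (parabolic_face T).
Proof.
move=> Tf; split.
- split=> [x y|c x c0]; rewrite !parabolic_faceE //.
    move=> [xZ xT] [yZ yT]; split; first exact: orbit_cone_convex.1.
    exact: cone_ge0_add.
  by move=> [xZ xT]; split; [exact: orbit_cone_convex.2|exact: (cone_ge0_convex _ _).2].
- by move=> x; rewrite parabolic_faceE // => -[].
move=> x y [xZ /= xF] yZ; split; first exact: orbit_cone_convex.1.
rewrite parabolic_faceE // => -[_ xyT]; apply: xF; rewrite parabolic_faceE //.
by split=> //; apply: facial_absorb xyT => //; exact: orbit_cone_Q.
Qed.

Lemma parabolic_face_0 T : parabolic_face T 0.
Proof.
exists [::] => //=; split; first exact: cone_ge0_0.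
by apply/antidominantE => i; rewrite lf0.
Qed.

(** Faciality of [T'] puts each single [c i *: h i] into its cone, which the functional of the
    [i]-th facet excludes unless [i] is in [T']. *)
Lemma cone_gt0_facial_sub T T' x : facial h T' -> cone_gt0 h T x -> cone_ge0 h T' x ->
  T \subset T'.
Proof.
move=> T'f [c /= c0 <-] xT'; apply/fintype.subsetP => i iT; apply: contraT => iT'.
have : cone_ge0 h T' (c i *: h i).
  move: xT'; rewrite (bigD1 i) //=; apply: facial_absorb => //.
    by apply: cone_ge0_scale (Q_gen i); exact/ltW/c0.
  apply: cone_ge0_sum => j /andP[jT _]; apply: cone_ge0_scale (Q_gen j).
  exact/ltW/c0.
have [l li lj] := facet_inhabited i; move=> [d /= d0 dE].
have dk k : k \in T' -> d k = 0.
  have /eqP := congr1 (fun v => l v : R) dE; rewrite /= lfZ li mulr0 lf_sum.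
  have kNi k' : k' \in T' -> k' != i by apply: contraTneq => ->.
  rewrite psumr_eq0 => [/allP lk kT'|k' k'T']; last first.
    by rewrite lfZ mulr_ge0 ?d0 // ltW // lj // kNi.
  have /implyP/(_ kT') := lk k (mem_index_enum k).
  by rewrite lfZ mulf_eq0 (gt_eqF (lj _ (kNi _ kT'))) orbF => /eqP.
move: dE; rewrite big1 => [/esym/eqP|k kT']; last by rewrite dk ?scale0r.
by rewrite scaler_eq0 (negbTE (h_neq0 i)) orbF gt_eqF // c0.
Qed.

(** The support of a given representation of [x] need not be facial. [T] instead collects the
    generators of the smallest face containing [x]: those [h i] of which a positive multiple can be
    subtracted inside [Q]. *)
Lemma cone_support x : Q x -> exists2 T, facial h T & cone_gt0 h T x.
Proof.
move=> Qx; pose T : {set 'I_n} := [set i | `[< exists2 e : R, 0 < e & Q (x - e *: h i) >]]%SET.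
have TP i : i \in T <-> exists2 e : R, 0 < e & Q (x - e *: h i).
  by rewrite inE; split=> [/asboolP|?]; last exact/asboolP.
have below y (e : R) : 0 < e -> Q y -> Q (x - e *: y) -> cone_ge0 h T y.
  move=> e0 /cone_ge0_setT[c c0 ->] Qe; apply: cone_ge0_sum => i _.
  have [->|ci0] := eqVneq (c i) 0; first by rewrite scale0r; exact: cone_ge0_0.
  apply: cone_ge0_scale => //; apply: cone_ge0_gen; apply/TP.
  exists (e * c i); first by rewrite mulr_gt0 // lt_def ci0 c0.
  move: Qe; rewrite (bigD1 i) //= scalerDr opprD addrA scalerA => Qe.
  rewrite -[_ - _](subrK (e *: \sum_(j < n | j != i) c j *: h j)).
  apply: cone_ge0_add => //; apply: cone_ge0_scale; first exact: ltW.
  by apply: cone_ge0_sum => j _; apply: cone_ge0_scale (Q_gen j).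
exists T.
  split; first exact: cone_ge0_convex.
    by move=> y; apply: cone_ge0_sub; exact: finset.subsetT.
  move=> a b [Qa aT] Qb; split; first exact: cone_ge0_add.
  move=> abT; apply: aT.
  suff [e e0 Qe] : exists2 e : R, 0 < e & Q (x - e *: (a + b)).
    apply: (below _ e) => //; rewrite -[_ - _](subrK (e *: b)); apply: cone_ge0_add.
      by rewrite -addrA -opprD -scalerDr.
    by apply: cone_ge0_scale => //; exact: ltW.
  have [d d0 ->] : exists2 d : 'I_n -> R, forall i, 0 <= d i & a + b = \sum_(i in T) d i *: h i.
    move: abT => [d /= d0 <-]; exists (fun i => if i \in T then d i else 0) => [i|].
      by case: ifP => // /d0.
    by apply: eq_bigr => i ->.
  have /choice[e eP] : forall i, exists e : R, i \in T -> 0 < e /\ Q (x - e *: h i).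
    move=> i; have [/TP[e e0 Qe]|_] := boolP (i \in T); first by exists e.
    by exists 0.
  (* With these weights [x - (1 + s)^-1 (a + b)] is a convex combination of [x] and the
     [x - e_i h_i]. *)
  pose s := \sum_(i in T) d i / e i.
  have de i : i \in T -> 0 <= d i / e i by move=> /eP[e0 _]; rewrite divr_ge0 // ltW.
  have s0 : 0 <= s by exact: sumr_ge0.
  exists (1 + s)^-1; first by rewrite invr_gt0 ltr_pwDl.
  have -> : x - (1 + s)^-1 *: (\sum_(i in T) d i *: h i)
     = (1 + s)^-1 *: (x + \sum_(i in T) (d i / e i) *: (x - e i *: h i)).
    have -> : \sum_(i in T) (d i / e i) *: (x - e i *: h i)
       = s *: x - \sum_(i in T) d i *: h i.
      under eq_bigr do rewrite scalerBr.
      rewrite sumrB -scaler_suml; congr (_ - _); apply: eq_bigr => i /eP[e0 _].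
      by rewrite scalerA divfK // gt_eqF.
    rewrite addrA -[X in X + _ *: x]scale1r -scalerDl scalerBr scalerA.
    by rewrite mulVf ?scale1r // gt_eqF // ltr_pwDl.
  apply: cone_ge0_scale; first by rewrite invr_ge0 addr_ge0.
  apply: cone_ge0_add => //; apply: cone_ge0_sum => i iT; apply: cone_ge0_scale.
    exact: de.
  by have [] := eP i iT.
have /choice[e eP] : forall i, exists e : R, i \in T -> 0 < e /\ Q (x - e *: h i).
  move=> i; have [/TP[e e0 Qe]|_] := boolP (i \in T); first by exists e.
  by exists 0.
pose m : R := #|T|%:R + 1.
have m0 : 0 < m by rewrite ltr_wpDl.
(* The mean of [x] and the [x - e_i h_i]; it differs from [x] by a combination with all coefficients
   positive, which makes a representation of [x] positive on all of [T]. *)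
pose y := m^-1 *: (x + \sum_(i in T) (x - e i *: h i)).
have yE : x = \sum_(i in T) (m^-1 * e i) *: h i + y.
  have -> : y = x - \sum_(i in T) (m^-1 * e i) *: h i.
    rewrite /y sumrB sumr_const addrA -mulrS -scaler_nat -natr1 -/m scalerBr scalerA.
    rewrite mulVf ?gt_eqF // scale1r scaler_sumr; congr (_ - _).
    by apply: eq_bigr => i _; rewrite scalerA.
  by rewrite addrC subrK.
have Qy : Q y.
  apply: cone_ge0_scale; first by rewrite invr_ge0 ltW.
  by apply: cone_ge0_add => //; apply: cone_ge0_sum => i /eP[].
rewrite yE; apply: cone_gt0_add.
  by exists (fun i => m^-1 * e i) => //= i /eP[e0 _]; rewrite mulr_gt0 ?invr_gt0.
apply: (below _ 1) => //; rewrite scale1r yE addrK.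
apply: cone_ge0_sum => i /eP[e0 _]; apply: cone_ge0_scale (Q_gen i).
by rewrite mulr_ge0 ?invr_ge0 // ltW.
Qed.

(** * Special sets and the Cartan matrix *)

Local Notation a_ i k := (cartan h alpha i k).

Lemma cartan_offdiag_le0 i k : i != k -> a_ i k <= 0.
Proof. by move=> ik; apply: cartan_le0; rewrite eq_sym. Qed.

Lemma cartan_sym0 i k : a_ i k = 0 -> a_ k i = 0.
Proof. exact: cartan_eq0. Qed.

(** Otherwise [i |: D] would be connected, against maximality: a separation of it either separates
    [D] or isolates [i]. In one of the two orders the latter uses the symmetry of zero entries. *)
Lemma component_separated J D i k : component_of h alpha J D ->
  i \in J -> i \notin D -> k \in D -> a_ i k = 0.
Proof.
move=> [DJ [D0 Dconn] Dmax] iJ iD kD; apply: contrapT => aik.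
suff /Dmax E : connected_set h alpha (i |: D).
  move: iD; rewrite -E ?finset.setU11 //; first by rewrite finset.subUset finset.sub1set iJ.
  exact: finset.subsetUr.
split; first by apply/finset.set0Pn; exists i; rewrite finset.setU11.
move=> [J1 [J2 [J10 J20 J12 JE sep]]].
have inJ (x : 'I_n) : x \in D -> (x \in J1) || (x \in J2).
  by move=> xD; rewrite -finset.in_setU -JE finset.in_setU1 xD orbT.
have subi (S : {set 'I_n}) (x : 'I_n) :
    (x \in S -> x \in i |: D)%SET -> x \in S -> x \notin D -> x = i.
  by move=> xS xS' xD; have := xS xS'; rewrite finset.in_setU1 (negbTE xD) orbF => /eqP.
have J1D (x : 'I_n) : x \in J1 -> (x \in i |: D)%SET by rewrite JE finset.in_setU => ->.
have J2D (x : 'I_n) : x \in J2 -> (x \in i |: D)%SET.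
  by rewrite JE finset.in_setU => ->; rewrite orbT.
have [DJ10|DJ1] := eqVneq (D :&: J1)%SET finset.set0.
  have DJ1F (x : 'I_n) : x \in D -> x \notin J1.
    by move=> xD; apply/negP => xJ; have := finset.in_set0 x; rewrite -DJ10 finset.in_setI xD xJ.
  have [x xJ1] := finset.set0Pn _ J10.
  have xi : x = i by apply: (subi J1); [exact: J1D| |apply: contraL xJ1; exact: DJ1F].
  apply: aik; apply: sep; first by rewrite -xi.
  by have := inJ _ kD; rewrite (negbTE (DJ1F _ kD)).
have [DJ20|DJ2] := eqVneq (D :&: J2)%SET finset.set0.
  have DJ2F (x : 'I_n) : x \in D -> x \notin J2.
    by move=> xD; apply/negP => xJ; have := finset.in_set0 x; rewrite -DJ20 finset.in_setI xD xJ.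
  have [x xJ2] := finset.set0Pn _ J20.
  have xi : x = i by apply: (subi J2); [exact: J2D| |apply: contraL xJ2; exact: DJ2F].
  apply: aik; apply: cartan_sym0; apply: sep; last by rewrite -xi.
  by have := inJ _ kD; rewrite (negbTE (DJ2F _ kD)) orbF.
apply: Dconn; exists (D :&: J1)%SET, (D :&: J2)%SET; split=> //.
- by rewrite finset.setIACA J12 finset.setI0.
- rewrite -finset.setIUr; apply/esym/finset.setIidPl; apply/fintype.subsetP => x /inJ.
  by rewrite finset.in_setU.
- by move=> j j'; rewrite !finset.in_setI => /andP[_ jJ] /andP[_ jJ']; exact: sep.
Qed.

Lemma alpha_cone k J (c : 'I_n -> R) :
  (alpha k (\sum_(i in J) c i *: h i) : R) = \sum_(i in J) c i * a_ i k.
Proof. by rewrite lf_sum; apply: eq_bigr => i _; rewrite lfZ /cartan. Qed.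

(** Pair the vector [u] of a finite type component [D] with the nonpositive values [alpha k x].
    Exchanging the sums gives the positive numbers [c i * (a u) i] for [i] in [D] and 0 for the
    other [i], a contradiction. *)
Lemma antidominant_special J x : cone_gt0 h J x -> antidominant x -> special h alpha J.
Proof.
move=> [c /= c0 xE] xa D Dcomp [u [u0 uD]].
have [DJ [/finset.set0Pn[d dD] _] _] := Dcomp.
have : \sum_(k in D) u k * (alpha k x : R) <= 0.
  by apply: sumr_le0 => k kD; rewrite mulr_ge0_le0 ?xa // ltW ?u0.
have -> : \sum_(k in D) u k * (alpha k x : R) =
    \sum_(k in D) \sum_(i in J) u k * (c i * a_ i k).
  by apply: eq_bigr => k _; rewrite -xE alpha_cone mulr_sumr.
rewrite exchange_big /= leNgt => /negP; apply.
have E i : \sum_(k in D) u k * (c i * a_ i k) = c i * \sum_(k in D) a_ i k * u k.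
  by rewrite mulr_sumr; apply: eq_bigr => k _; ring.
under eq_bigr do rewrite E.
have dJ := fintype.subsetP DJ d dD.
rewrite (bigD1 d) //= ltr_pwDl //; first by rewrite mulr_gt0 ?c0 ?uD.
apply: sumr_ge0 => i /andP[iJ _]; apply: mulr_ge0; first exact/ltW/c0.
have [iD|iD] := boolP (i \in D); first by exact/ltW/uD.
by rewrite big1 // => k kD; rewrite (component_separated Dcomp iJ iD kD) mul0r.
Qed.

Lemma connected_component T t : t \in T ->
  exists2 D, component_of h alpha T D & t \in D.
Proof.
move=> tT; pose P (D : {set 'I_n}) := [&& D \subset T, t \in D & `[< connected_set h alpha D >]].
have P0 : P [set t]%SET.
  rewrite /P finset.sub1set tT finset.set11; apply/asboolP; split.
    by apply/finset.set0Pn; exists t; rewrite finset.set11.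
  move=> [J1 [J2 [/finset.set0Pn[x xJ] /finset.set0Pn[y yJ] J12 E _]]].
  have xt : x = t by apply/finset.set1P; rewrite E finset.in_setU xJ.
  have yt : y = t by apply/finset.set1P; rewrite E finset.in_setU yJ orbT.
  by have := finset.in_set0 t; rewrite -J12 finset.in_setI -{1}xt xJ -yt yJ.
have /= [D /and3P[DT tD /asboolP Dc] Dmax] := @arg_maxnP _ _ P (fun D => #|D|) P0.
exists D => //; split=> // D' D'T D'c DD'.
apply/esym/eqP; rewrite eqEcard DD'; apply: Dmax; rewrite /P D'T /=; apply/andP; split.
  exact: (fintype.subsetP DD').
exact/asboolP.
Qed.

(* A solution of maximal support: enlarging it is possible unless the remaining
   indices are separated from the support, and then Gordan's alternative produces
   a component of finite type. *)
Lemma special_solution T : special h alpha T ->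
  exists2 c : 'I_n -> R, forall i, i \in T -> 0 < c i &
    forall k, k \in T -> \sum_(i in T) c i * a_ i k <= 0.
Proof.
move=> Tspecial.
pose sol (S : {set 'I_n}) (c : 'I_n -> R) := (forall i, i \in S -> 0 < c i) /\
  forall k, k \in T -> \sum_(i in S) c i * a_ i k <= 0.
pose P (S : {set 'I_n}) := (S \subset T) && `[< exists c, sol S c >].
have P0 : P finset.set0.
  rewrite /P finset.sub0set; apply/asboolP; exists (fun=> 0); split=> [i|k _].
    by rewrite finset.in_set0.
  by rewrite big_set0.
have /= [S /andP[ST /asboolP[c [c0 cS]]] Smax] := @arg_maxnP _ _ P (fun S => #|S|) P0.
have {}Smax (S' : {set 'I_n}) : P S' -> (#|S'| <= #|S|)%N := Smax S'.
have [TS|/fintype.subsetPn[t tT tS]] := boolP (T \subset S).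
  have ES : S = T by apply/eqP; rewrite finset.eqEsubset ST.
  by move: c0 cS; rewrite ES => c0 cS; exists c.
exfalso.
have sepS i k : i \in S -> k \in T -> k \notin S -> a_ i k = 0.
  move=> iS kT kS.
  have ik j : j \in S -> a_ j k <= 0.
    by move=> jS; apply: cartan_offdiag_le0; apply: contraNneq kS => <-.
  have ck j : j \in S -> 0 <= - (c j * a_ j k).
    by move=> jS; rewrite oppr_ge0 mulr_ge0_le0 ?ik // ltW ?c0.
  have [s0|s_lt0] := eqVneq (\sum_(j in S) c j * a_ j k) 0.
    have /eqP : \sum_(j in S) - (c j * a_ j k) = 0 by rewrite sumrN s0 oppr0.
    rewrite psumr_eq0 // => /allP/(_ i (mem_index_enum i))/implyP/(_ iS).
    by rewrite oppr_eq0 mulf_eq0 (gt_eqF (c0 _ iS)) => /eqP.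
  have {}s_lt0 : \sum_(j in S) c j * a_ j k < 0 by rewrite lt_neqAle s_lt0 cS.
  have /Smax : P (k |: S)%SET.
    rewrite /P finset.subUset finset.sub1set kT ST; apply/asboolP.
    (* The diagonal entry is 2, so this weight of [k] raises the negative sum exactly to 0. *)
    pose e := - (\sum_(j in S) c j * a_ j k) / 2.
    have e0 : 0 < e by rewrite divr_gt0 // oppr_gt0.
    exists (fun j => if j == k then e else c j); split=> [j|l lT].
      by rewrite finset.in_setU1; case: eqP => //= _; exact: c0.
    rewrite finset.big_setU1 //= eqxx.
    have -> : \sum_(j in S) (if j == k then e else c j) * a_ j l
        = \sum_(j in S) c j * a_ j l.
      by apply: eq_bigr => j jS; rewrite ifN //; apply: contraNneq kS => <-.
    have [->|lk] := eqVneq l k.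
      have -> : a_ k k = 2 by exact: alpha_hR.
      by rewrite /e; lra.
    have := cS l lT; have : e * a_ k l <= 0.
      by apply: mulr_ge0_le0; [exact: ltW|apply: cartan_offdiag_le0; rewrite eq_sym].
    by lra.
  by rewrite finset.cardsU1 kS /= add1n ltnn.
pose U := (T :\: S)%SET.
have UP k : k \in U -> k \in T /\ k \notin S by rewrite finset.in_setD => /andP[].
(* The second alternative enlarges the support by a nonzero [d], against maximality. In the first,
   restricting [u] to a component inside [U] only drops nonpositive terms. *)
have [[u u0 uU]|[d d0 [[i0 i0U di0] dU]]] := gordan (fun i k => a_ i k) U; last first.
  pose D := [set i in U | 0 < d i]%SET.
  have SDI : ((S :|: D) :&: S)%SET = S by apply/finset.setIidPr; exact: finset.subsetUl.
  have SDD : ((S :|: D) :\: S)%SET = D.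
    by apply/finset.setP => i; rewrite /D /U !inE; case: (i \in S).
  have dD k : \sum_(i in D) d i * a_ i k = \sum_(i in U) d i * a_ i k.
    rewrite [RHS](bigID (fun i => 0 < d i)) /= [X in _ = _ + X]big1 ?addr0.
      by apply: eq_bigl => i; rewrite inE.
    move=> i /andP[_]; rewrite -leNgt => di; suff -> : d i = 0 by rewrite mul0r.
    by apply/eqP; rewrite eq_le di d0.
  have /Smax : P (S :|: D)%SET.
    rewrite /P finset.subUset ST /=; apply/andP; split.
      by apply/fintype.subsetP => i; rewrite inE => /andP[/UP[]].
    apply/asboolP; exists (fun i => if i \in S then c i else d i); split=> [i|k kT].
      by rewrite finset.in_setU inE; case: ifP => [/c0|_ /= /andP[]].
    rewrite (finset.big_setID S) /= SDI SDD.
    have -> : \sum_(i in S) (if i \in S then c i else d i) * a_ i k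
        = \sum_(i in S) c i * a_ i k by apply: eq_bigr => i ->.
    have -> : \sum_(i in D) (if i \in S then c i else d i) * a_ i k
        = \sum_(i in D) d i * a_ i k.
      by apply: eq_bigr => i; rewrite inE => /andP[/UP[_ /negbTE->]].
    rewrite dD; have := cS k kT.
    suff : \sum_(i in U) d i * a_ i k <= 0 by lra.
    have [kS|kS] := boolP (k \in S); last by apply: dU; rewrite finset.in_setD kS.
    apply: sumr_le0 => i /UP[_ iS]; apply: mulr_ge0_le0 => //.
    by apply: cartan_offdiag_le0; apply: contraNneq iS => ->.
  rewrite leqNgt => /negP; apply; apply: proper_card; apply/fintype.properP.
  split; first exact: finset.subsetUl.
  exists i0; first by rewrite finset.in_setU inE i0U di0 orbT.
  by have [] := UP _ i0U.
have [D Dcomp tD] := connected_component tT.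
have [DT [_ Dconn] _] := Dcomp.
have DU : D \subset U.
  apply/fintype.subsetP => i iD; rewrite finset.in_setD (fintype.subsetP DT) // andbT.
  apply/negP => iS; apply: Dconn; exists (D :&: S)%SET, (D :\: S)%SET; split.
  - by apply/finset.set0Pn; exists i; rewrite finset.in_setI iD.
  - by apply/finset.set0Pn; exists t; rewrite finset.in_setD tS.
  - apply/finset.setP => j.
    by rewrite !finset.in_setI finset.in_setD finset.in_set0; case: (j \in S); rewrite /= ?andbF.
  - by rewrite finset.setID.
  move=> j k; rewrite finset.in_setI finset.in_setD => /andP[_ jS] /andP[kS kD].
  by apply: sepS => //; exact: (fintype.subsetP DT).
apply: Tspecial Dcomp _; exists u; split=> [i iD|i iD].
  exact/u0/(fintype.subsetP DU).
have iU := fintype.subsetP DU i iD.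
apply: lt_le_trans (uU i iU) _.
rewrite (finset.big_setID D) /= (finset.setIidPr DU) gerDl; apply: sumr_le0 => k.
rewrite finset.in_setD => /andP[kD kU]; apply: mulr_le0_ge0; last exact/ltW/u0.
by apply: cartan_offdiag_le0; apply: contraNneq kD => <-.
Qed.

Lemma K_open_nonempty T : special h alpha T -> K_open h alpha T !=set0.
Proof.
move=> /special_solution[c c0 cT]; exists (\sum_(i in T) c i *: h i); split.
  by exists c.
apply/antidominantE => k; have [kT|kT] := boolP (k \in T).
  by rewrite alpha_cone cT.
by apply: cone_off kT; apply: cone_gt0_ge0; exists c.
Qed.

(** * Strata of [K] and the relative interior of the faces *)

Lemma coneK_stratum x : coneK h alpha x ->
  exists2 T, special_facial h alpha T & K_open h alpha T x.
Proof.
move=> [Qx xa]; have [T Tf xT] := cone_support Qx.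
by exists T; split=> //; apply: antidominant_special xT _; exact/antidominantE.
Qed.

Lemma K_open_closed T x : K_open h alpha T x -> K_closed h alpha T x.
Proof. by move=> [xT xa]; split=> //; exact: cone_gt0_ge0. Qed.

Lemma K_open_face T x : K_open h alpha T x -> parabolic_face T x.
Proof. by move=> xK; exists [::] => //=; exact: K_open_closed. Qed.

Lemma K_closed_coneK T x : K_closed h alpha T x -> coneK h alpha x.
Proof. by move=> [xT xa]; split=> //; exact: cone_ge0_sub (finset.subsetT _) xT. Qed.

Lemma K_open_add T x y : K_open h alpha T x -> K_open h alpha T y ->
  K_open h alpha T (x + y).
Proof.
move=> [xT /antidominantE xa] [yT /antidominantE ya]; split.
  exact: cone_gt0_add (cone_gt0_ge0 yT).
by apply/antidominantE => i; rewrite lfD; have := xa i; have := ya i; lra.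
Qed.

Lemma parabolic_face_convex T : facial h T -> convex_cone (parabolic_face T).
Proof. by move=> /parabolic_face_face[]. Qed.

Lemma core_wact T w x : facial h T -> all (mem T) w ->
  core (parabolic_face T) x -> core (parabolic_face T) (wact w x).
Proof.
move=> Tf wT [xF xc]; split; first exact: parabolic_face_wact.
move=> y yF; have [|e e0 eF] := xc (wact (rev w) y).
  by apply: parabolic_face_wact; rewrite ?all_rev.
exists e => //; have := parabolic_face_wact Tf wT eF.
by rewrite linearB linearZ /= wactVK.
Qed.

Lemma special_facial_unique T T' x : facial h T -> facial h T' ->
  cone_gt0 h T x -> cone_gt0 h T' x -> T = T'.
Proof.
move=> Tf T'f xT xT'; apply/eqP; rewrite finset.eqEsubset; apply/andP; split.
  exact: cone_gt0_facial_sub xT (cone_gt0_ge0 xT').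
exact: cone_gt0_facial_sub xT' (cone_gt0_ge0 xT).
Qed.

(** The point reaches some stratum [T']. Being interior to the face of [T], it puts that face inside
    the face of [T'], and a point of the nonempty [K(T)] then gives the inclusion of [T] in [T'];
    the converse is read off from the point itself. *)
Lemma core_K_open T x : special_facial h alpha T -> core (parabolic_face T) x ->
  exists2 w, all (mem T) w & K_open h alpha T (wact w x).
Proof.
move=> [Ts Tf] xc; have [[w wT wxK] _] := xc; exists w => //.
have [T' [T's T'f] wxK'] := coneK_stratum (K_closed_coneK wxK).
suff -> : T = T' by [].
have sub : parabolic_face T `<=` parabolic_face T'.
  apply: (core_face_sub (parabolic_face_convex Tf) _ (parabolic_face_face T'f)
    (core_wact Tf wT xc) (K_open_face wxK')).
  by have [] := parabolic_face_face Tf.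
have [y yK] := K_open_nonempty Ts.
apply/eqP; rewrite finset.eqEsubset; apply/andP; split.
  apply: cone_gt0_facial_sub yK.1 _ => //.
  by have /sub := K_open_face yK; rewrite parabolic_faceE // => -[].
exact: cone_gt0_facial_sub wxK'.1 wxK.1.
Qed.

(** Each [alpha j] is nonpositive on [K(T)], so it vanishes at a sum only if it vanishes at every
    summand. Adding one witness for each [j] to an interior point keeps it interior and minimizes
    the set of vanishing [alpha j]. *)
Lemma generic_K_open T : special_facial h alpha T ->
  exists2 x, core (parabolic_face T) x & K_open h alpha T x /\
    forall j, (alpha j x : R) = 0 -> forall y, K_open h alpha T y -> (alpha j y : R) = 0.
Proof.
move=> Tsf; have [Ts Tf] := Tsf; have Fc := parabolic_face_convex Tf.
have [z zc] := core_nonempty Fc (parabolic_face_0 T).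
have [w wT xK] := core_K_open Tsf zc; have xc := core_wact Tf wT zc.
set x := wact w z in xK xc.
have /choice[y yP] : forall j, exists y, K_open h alpha T y /\
    ((alpha j y : R) = 0 -> forall y', K_open h alpha T y' -> (alpha j y' : R) = 0).
  move=> j; have [[y yK yj]|no] := pselect (exists2 y, K_open h alpha T y & (alpha j y : R) != 0).
    by exists y; split=> // y0; rewrite y0 eqxx in yj.
  by exists x; split=> // _ y' y'K; apply: contrapT => /eqP y'j; apply: no; exists y'.
have sumF (r : seq 'I_n) : core (parabolic_face T) (x + \sum_(j <- r) y j) /\
    K_open h alpha T (x + \sum_(j <- r) y j).
  elim: r => [|j r [IHc IHK]]; first by rewrite big_nil addr0.
  rewrite big_cons addrCA addrC; have [yK _] := yP j; split.
    by apply: core_add => //; exact: K_open_face.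
  exact: K_open_add.
exists (x + \sum_j y j); first by have [] := sumF (index_enum 'I_n).
split; first by have [] := sumF (index_enum 'I_n).
move=> j; rewrite lfD lf_sum => /eqP.
have neg y' : K_open h alpha T y' -> 0 <= - (alpha j y' : R).
  by move=> [_ /antidominantE]; rewrite oppr_ge0.
have nyj i : true -> 0 <= - (alpha j (y i) : R) by move=> _; apply: neg; have [] := yP i.
rewrite -oppr_eq0 opprD -sumrN paddr_eq0 ?neg // => [/andP[_]|]; last exact: sumr_ge0.
rewrite psumr_eq0 // => /allP/(_ j (mem_index_enum j)) /=; rewrite oppr_eq0 => /eqP.
by have [] := yP j.
Qed.

Lemma generic_separated T x i j : K_open h alpha T x ->
  (forall j, (alpha j x : R) = 0 -> forall y, K_open h alpha T y -> (alpha j y : R) = 0) ->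
  i \in T -> (alpha i x : R) < 0 -> (alpha j x : R) = 0 -> a_ i j = 0.
Proof.
move=> xK xgen iT xi xj; have [xT /antidominantE xa] := xK.
(* This step along [h i] makes [alpha i] vanish and does not raise the other values, so [x + d h_i]
   stays in [K(T)]. *)
pose d := - (alpha i x : R) / 2; have d0 : 0 < d by rewrite divr_gt0 // oppr_gt0.
have : (alpha j (x + d *: h i) : R) = 0.
  apply: xgen => //; split.
    by apply: cone_gt0_add => //; apply: cone_ge0_scale; [exact: ltW|exact: cone_ge0_gen].
  apply/antidominantE => k; rewrite lfD lfZ; have [->|ki] := eqVneq k i.
    by rewrite alpha_hR /d; lra.
  have := xa k; have : d * (alpha k (h i) : R) <= 0.
    by apply: mulr_ge0_le0; [exact: ltW|exact: cartan_le0].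
  by lra.
by rewrite lfD lfZ xj add0r => /eqP; rewrite mulf_eq0 (gt_eqF d0) => /eqP.
Qed.

Lemma refl_lfun_involution j : (linfun (refl j) \o linfun (refl j) = \1)%VF.
Proof. by apply/lfunP => x; rewrite comp_lfunE id_lfunE !lfunE /= reflK. Qed.

Lemma K_open_core T x : special_facial h alpha T -> K_open h alpha T x ->
  core (parabolic_face T) x.
Proof.
move=> Tsf xK; have [_ Tf] := Tsf; apply: contrapT => xNc.
have [x1 x1c [x1K x1gen]] := generic_K_open Tsf.
have Fc := parabolic_face_convex Tf; have F0 := parabolic_face_0 T.
have [l [lF lx [y yF ly] linv]] := invariant_support Fc F0 (K_open_face xK) x1c xNc.
have [xT /antidominantE xa] := xK; have [x1T /antidominantE x1a] := x1K.
have reflF j z : j \in T -> parabolic_face T z -> parabolic_face T (refl j z).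
  by move=> jT; apply: (@parabolic_face_wact T [:: j]) => //=; rewrite jT.
(* If [refl j] fixes [x], the inequality at [x1] decides the sign; otherwise [refl j x] lies in the
   face, and as [l x = 0] its value is a positive multiple of [l (h j)]. *)
have lh j : j \in T -> (alpha j x1 : R) < 0 -> 0 <= (l (h j) : R).
  move=> jT x1j; have := xa j; rewrite le_eqVlt => /orP[/eqP xj|xj].
    have : (l x1 : R) <= l (linfun (refl j) x1).
      apply: linv; last exact: refl_lfun_involution.
        by move=> z zF; rewrite lfunE; exact: reflF.
      by rewrite lfunE /= /refl xj scale0r subr0.
    rewrite lfunE /= /refl lfB lfZ -subr_ge0 addrAC subrr sub0r -mulNr.
    by rewrite pmulr_rge0 // oppr_gt0.
  have := lF _ (reflF _ _ jT (K_open_face xK)).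
  by rewrite /refl lfB lfZ lx sub0r -mulNr pmulr_rge0 // oppr_gt0.
have [e e0 [d /= d0 dE]] := cone_gt0_sub xT (cone_gt0_ge0 x1T).
(* On [M] the sign of [l (h j)] is unknown. But for [k] in [M], [alpha k] kills [x] and [x1] by
   genericity and the [h i] with [i] in [T :\: M] by separation, hence also the [M]-part of
   [x - e x1]; that part is thus antidominant and lies in the face. *)
pose M := [set j in T | (alpha j x1 : R) == 0]%SET.
have MP j : j \in M -> j \in T /\ (alpha j x1 : R) = 0.
  by rewrite inE => /andP[jT /eqP].
have MN j : j \in (T :\: M)%SET -> j \in T /\ (alpha j x1 : R) < 0.
  rewrite !inE => /andP[+ jT]; rewrite jT /= => x1j; split=> //.
  by rewrite lt_neqAle x1j x1a.
have MT : M \subset T by apply/fintype.subsetP => j /MP[].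
have dMN : x - e *: x1 = \sum_(j in M) d j *: h j + \sum_(j in T :\: M) d j *: h j.
  by rewrite -dE (finset.big_setID M) /= (finset.setIidPr MT).
have coneM : cone_ge0 h M (\sum_(j in M) d j *: h j).
  by exists d => //= j /MP[jT _]; exact/ltW/d0.
have MF : parabolic_face T (\sum_(j in M) d j *: h j).
  exists [::] => //=; split; first exact: cone_ge0_sub coneM.
  apply/antidominantE => k.
  have [/MP[kT x1k]|kM] := boolP (k \in M); last exact: cone_off coneM kM.
  have /eqP := congr1 (fun v => alpha k v : R) dMN.
  rewrite /= lfB lfZ x1k (x1gen _ x1k _ xK) mulr0 subr0 lfD [X in _ + X]alpha_cone.
  rewrite [X in _ + X]big1 => [|i /MN[iT x1i]]; first by rewrite addr0 => /eqP <-.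
  by rewrite (generic_separated x1K x1gen iT x1i x1k) mulr0.
have lx1 : (l x1 : R) = 0.
  apply/eqP; rewrite eq_le (lF _ x1c.1) andbT.
  have : 0 <= (l (x - e *: x1) : R).
    rewrite dMN lfD; apply: addr_ge0; first exact: lF.
    rewrite lf_sum; apply: sumr_ge0 => j /MN[jT x1j].
    by rewrite lfZ mulr_ge0 ?lh // ltW // d0.
  by rewrite lfB lfZ lx sub0r oppr_ge0 pmulr_rle0.
have [e' e'0 /lF] := x1c.2 y yF.
rewrite lfB lfZ lx1 sub0r oppr_ge0 pmulr_rle0 // => ly0.
by move/eqP: ly; apply; apply/eqP; rewrite eq_le ly0 lF.
Qed.

Lemma core_parabolic_face T : special_facial h alpha T ->
  core (parabolic_face T) =
  [set x | exists2 w, all (mem T) w & K_open h alpha T (wact w x)].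
Proof.
move=> Tsf; apply/seteqP; split=> x; first exact: core_K_open.
move=> [w wT wxK]; rewrite -(wactK w x).
by apply: core_wact; [case: Tsf|rewrite all_rev|exact: K_open_core].
Qed.

(** * Orbits of faces *)

Lemma wact_face w F : face orbit_cone F -> face orbit_cone (wact w @` F).
Proof.
move=> [[FD FZ'] FZ Fface]; split.
- split=> [_ _ [x xF <-] [y yF <-]|c _ c0 [x xF <-]].
    by exists (x + y); [exact: FD|rewrite linearD].
  by exists (c *: x); [exact: FZ'|rewrite linearZ].
- by move=> _ [x xF <-]; apply: orbit_cone_wact; exact: FZ.
move=> x y [xZ xF] yZ; split; first exact: orbit_cone_convex.1.
move=> [z zF zE]; have [||_] := Fface (wact (rev w) x) (wact (rev w) y).
- split; first exact: orbit_cone_wact.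
  by move=> x'F; apply: xF; exists (wact (rev w) x) => //; rewrite wactVK.
- exact: orbit_cone_wact.
- by rewrite -linearD /= -zE wactK.
Qed.

Lemma wact_core w F x : core F x -> core (wact w @` F) (wact w x).
Proof.
move=> [xF xc]; split; first by exists x.
move=> _ [y yF <-]; have [e e0 eF] := xc y yF; exists e => //.
by exists (x - e *: y); rewrite // linearB linearZ.
Qed.

Lemma K_open_core_face T F x : special_facial h alpha T -> face orbit_cone F ->
  core F x -> K_open h alpha T x -> F = parabolic_face T.
Proof.
move=> Tsf Ff xF xK; apply: core_face_eq Ff _ xF _; last exact: K_open_core.
by apply: parabolic_face_face; case: Tsf.
Qed.

(** An interior point of [F], moved into [K], lies in a stratum [K(T)], and faces sharing an
    interior point coincide. Uniqueness holds since an orbit meets the antidominant chamber at most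
    once. *)
Lemma orbit_cone_face_orbit F : Fa orbit_cone F -> exists! T : {set 'I_n},
  special_facial h alpha T /\ exists w, wact w @` F = parabolic_face T.
Proof.
move=> FFa; have [Ff _] := FFa; have [Fc FZ _] := Ff.
have [z zF] := core_nonempty Fc (Fa_0 orbit_cone_0 FFa).
have [w wzK] := FZ _ zF.1; have [T Tsf wzT] := coneK_stratum wzK.
have wF := K_open_core_face Tsf (wact_face w Ff) (wact_core w zF) wzT.
exists T; split=> [|T' [T'sf [u uF]]]; first by split=> //; exists w.
have uz : core (parabolic_face T') (wact u z) by rewrite -uF; exact: wact_core.
have [v vT' vuzK] := core_K_open T'sf uz.
have E : wact v (wact u z) = wact w z.
  have := antidominant_unique (w := v ++ u ++ rev w) (x := wact w z).
  rewrite !wact_cat wactK; apply; apply/antidominantE; first exact: wzK.2.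
  exact: vuzK.2.
rewrite E in vuzK.
exact: (special_facial_unique Tsf.2 T'sf.2 wzT.1 vuzK.1).
Qed.

Lemma orbit_cone_special_face F : Fa orbit_cone F ->
  (exists T : {set 'I_n}, special_facial h alpha T /\ F = parabolic_face T) <->
  (core F `&` coneK h alpha = core F `&` oppset (dual_chamber alpha) /\
   core F `&` coneK h alpha !=set0).
Proof.
move=> FFa; have [[Fc FZ Fface] _] := FFa; split=> [[T [Tsf FE]]|[_ [x [xF xK]]]].
  split.
    apply/seteqP; split=> x [xF]; first by case.
    by move=> xa; split=> //; split=> //; apply: orbit_cone_Q; apply: FZ; case: xF.
  have [x xK] := K_open_nonempty Tsf.1; exists x; split.
    by rewrite FE; exact: K_open_core.
  exact: K_closed_coneK (K_open_closed xK).
have [T Tsf xT] := coneK_stratum xK; exists T; split=> //.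
exact: K_open_core_face Tsf _ xF xT.
Qed.

End ReflectionGroup.

(** * Linear Coxeter systems *)

Section Translation.
Variables (R : realType) (V : vectType R) (n : nat).
Variables (H : 'I_n -> set V) (L : 'I_n -> set 'Hom(V, R^o)).
Variables (h : 'I_n -> V) (alpha : 'I_n -> 'Hom(V, R^o)).
Hypotheses (lcs : linear_coxeter_system H L).
Hypotheses (h_in : forall i, H i (h i)) (alpha_in : forall i, L i (alpha i)).
Hypothesis alpha_h : forall i, alpha i (h i) = 2.
Local Notation dualV := 'Hom(V, R^o).
Implicit Types (l : dualV) (i j : 'I_n) (w : seq 'I_n).

Lemma closed_ray_gen (W : vectType R) (S : set W) v x :
  closed_ray S -> S v -> v != 0 -> S x -> exists2 c : R, 0 <= c & x = c *: v.
Proof.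
move=> [u u0 ->] [a /= a0 <-] av0 [b /= b0 <-].
have a_neq0 : a != 0 by apply: contraNneq av0 => ->; rewrite scale0r.
exists (b / a); first by rewrite divr_ge0.
by rewrite scalerA divfK.
Qed.

Lemma H_gen i x : H i x -> exists2 c : R, 0 <= c & x = c *: h i.
Proof.
apply: closed_ray_gen (h_in i) _; first exact: (lcs_rayH lcs).
exact: h_neq0.
Qed.

Lemma alpha_neq0 i : alpha i != 0.
Proof.
apply/eqP => ai; have := alpha_h i; rewrite ai zero_lfunE => /esym/eqP.
by rewrite pnatr_eq0.
Qed.

Lemma L_gen i l : L i l -> exists2 c : R, 0 <= c & l = c *: alpha i.
Proof.
by apply: closed_ray_gen (alpha_in i) (alpha_neq0 i); exact: (lcs_rayL lcs).
Qed.

Lemma ray_eq0E i l : ray_eq0 (H i) l <-> (l (h i) : R) = 0.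
Proof.
split=> [/(_ _ (h_in i))//|lh x /H_gen[c _ ->]]; rewrite linearZ /=.
by rewrite -[l (h i)]/(l (h i) : R) lh scaler0.
Qed.

Lemma open_chamberE l : open_chamber H l <-> forall i, 0 < (l (h i) : R).
Proof.
split=> [lC i|lC i _ x /H_gen[c c0 ->]]; first exact: (lC i I _ (h_in i) (h_neq0 alpha_h i)).
rewrite scaler_eq0 negb_or => /andP[cn0 _]; rewrite lfZ mulr_gt0 //.
by rewrite lt_def cn0.
Qed.

Lemma closed_chamberE l : closed_chamber H l <-> forall i, 0 <= (l (h i) : R).
Proof.
split=> [lC i|lC i _ x /H_gen[c c0 ->]]; first exact: (lC i I _ (h_in i)).
by rewrite lfZ mulr_ge0.
Qed.

Definition eval_at (x : V) (l : dualV) : R^o := l x.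

Lemma eval_at_linear x : linear (eval_at x).
Proof. by move=> a l m; rewrite /eval_at add_lfunE scale_lfunE. Qed.

HB.instance Definition _ x :=
  GRing.isLinear.Build _ _ _ _ (eval_at x) (eval_at_linear x).

Definition eval_kernel (x : V) : {vspace dualV} := lker (linfun (eval_at x)).

Lemma eval_kernelE (x : V) l : l \in eval_kernel x = ((l x : R) == 0).
Proof. by rewrite memv_ker lfunE. Qed.

(** If the closed chamber vanished at [h i], it would span at most the kernel of evaluation there,
    which misses [alpha i]. One witness for each [i] is summed. *)
Lemma lcs_chamber_inhabited : exists rho : dualV, forall i, 0 < (rho (h i) : R).
Proof.
have /choice[l lP] : forall i, exists l : dualV, closed_chamber H l /\ 0 < (l (h i) : R).
  move=> i; apply: contrapT => no; have [_ span] := lcs_span lcs.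
  have : ~ (fullv <= eval_kernel (h i))%VS.
    move=> /subvP/(_ (alpha i) (memvf _)).
    by rewrite eval_kernelE (alpha_hR alpha_h) pnatr_eq0.
  apply; apply: span => l /[dup] lC /closed_chamberE l0 /=; rewrite eval_kernelE.
  apply/eqP/le_anti; rewrite l0 andbT leNgt; apply/negP => li.
  by apply: no; exists l.
exists (\sum_i l i) => i; rewrite sum_lfunE (bigD1 i) //= ltr_pwDl //; first by case: (lP i).
by apply: sumr_ge0 => j _; have [/closed_chamberE] := lP j.
Qed.

Lemma linear_span_unique (W : vectType R) (S : set W) (U U' : {vspace W}) :
  linear_span S U -> linear_span S U' -> U = U'.
Proof. by move=> [SU US] [SU' US']; apply/eqP; rewrite eqEsubv US ?US'. Qed.

(** One facet would lie inside another; having the same dimension, they have the same span, so each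
    lies in the hyperplane of the other and they coincide. *)
Lemma facet_not_sub i j : j != i ->
  ~ (closed_chamber H `&` ray_eq0 (H i) `<=` ray_eq0 (H j)).
Proof.
move=> /eqP ji Fij; apply: ji.
have [facet inj _] := lcs_facets lcs.
have [_ [K1 [U1 [K1s U1s d1]]]] := facet i I; have [_ [K2 [U2 [K2s U2s d2]]]] := facet j I.
have U12 : U1 = U2.
  apply/eqP; rewrite eqEdim -ltnS -d1 -d2 (linear_span_unique K1s K2s) leqnn andbT.
  by apply: U1s.2 => l lF; apply: U2s.1; split; [exact: lF.1|exact: Fij].
have U1k : (U1 <= eval_kernel (h i))%VS.
  by apply: U1s.2 => l [_ /ray_eq0E li] /=; rewrite eval_kernelE li.
apply: inj; [exact: mem_set|exact: mem_set|].
apply/seteqP; split=> l [lC lF]; split=> //; last exact: Fij.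
apply/ray_eq0E/eqP; rewrite -eval_kernelE; apply: (subvP U1k); rewrite U12.
exact: U2s.1.
Qed.

Lemma lcs_facet_inhabited i : exists2 l : dualV,
  l (h i) = 0 & forall j, j != i -> 0 < (l (h j) : R).
Proof.
have /choice[l lP] : forall j, exists l : dualV, [/\ closed_chamber H l,
    (l (h i) : R) = 0 & j != i -> 0 < (l (h j) : R)].
  move=> j; have [->|ji] := eqVneq j i.
    by exists 0; split=> //; [apply/closed_chamberE => k|]; rewrite zero_lfunE.
  apply: contrapT => no; apply: (facet_not_sub ji) => l [lC /ray_eq0E li].
  apply/ray_eq0E/le_anti; have /closed_chamberE -> := lC; rewrite andbT leNgt.
  by apply/negP => lj; apply: no; exists l.
exists (\sum_j l j) => [|j ji]; rewrite sum_lfunE.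
  by apply: big1 => j _; have [] := lP j.
rewrite (bigD1 j) //= ltr_pwDl //; first by have [_ _ ->] := lP j.
by apply: sumr_ge0 => k _; have [/closed_chamberE] := lP k.
Qed.

(** * The Coxeter group acting by words *)

Definition dual_refl_fun i l : dualV := l - (l (h i) : R) *: alpha i.

Lemma dual_refl_linear i : linear (dual_refl_fun i).
Proof.
move=> a l m; rewrite /dual_refl_fun lf_add lf_scale scalerDl opprD scalerBr addrACA.
by rewrite scalerA.
Qed.

HB.instance Definition _ i :=
  GRing.isLinear.Build _ _ _ _ (dual_refl_fun i) (dual_refl_linear i).

Definition dual_refl i : 'End(dualV) := linfun (dual_refl_fun i).

Lemma dual_reflE i l : dual_refl i l = l - (l (h i) : R) *: alpha i.
Proof. by rewrite lfunE. Qed.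

Lemma dual_refl_apply i l x : dual_refl i l x = l (refl h alpha i x).
Proof.
change ((dual_refl i l x : R) = (l (refl h alpha i x) : R)).
by rewrite dual_reflE /refl lfB lfZ -scaleNr lf_add lf_scale mulNr mulrC.
Qed.

Lemma reflection_at_alongE i (s : 'End(dualV)) :
  reflection_at_along (ray_eq0 (H i)) (L i `|` oppset (L i)) s <-> s = dual_refl i.
Proof.
split=> [[sH sL]|->].
  apply/lfunP => l; rewrite dual_reflE.
  have sa : s (alpha i) = - alpha i by apply: sL; left.
  (* As [alpha i (h i) = 2], subtracting [k *: alpha i] projects [l] onto the hyperplane along
     [alpha i]; the two conditions on [s] determine it on both parts. *)
  pose k : R := (l (h i) : R) / 2; pose m := l - k *: alpha i.
  have mH : ray_eq0 (H i) m.
    apply/ray_eq0E; rewrite /m -scaleNr lf_add lf_scale (alpha_hR alpha_h) /k.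
    by field.
  have -> : s l = m - k *: alpha i.
    by rewrite -{1}[l](subrK (k *: alpha i)) -/m linearD linearZ /= sH // sa scalerN.
  by rewrite /m -addrA -opprD -scalerDl; congr (_ - _ *: _); rewrite /k; field.
split=> [l /ray_eq0E lh|l lL]; first by rewrite dual_reflE lh scale0r subr0.
have [c ->] : exists c : R, l = c *: alpha i.
  case: lL => [/L_gen[c _ ->]|[l' /L_gen[c _ ->] <-]]; first by exists c.
  by exists (- c); rewrite scaleNr.
rewrite dual_reflE lf_scale (alpha_hR alpha_h) mulrC -scalerA scaler_nat mulr2n.
by rewrite opprD addNKr.
Qed.

Definition dual_word w : 'End(dualV) :=
  foldr (fun i s => (dual_refl i \o s)%VF) \1%VF w.

(** Transposition reverses words. The contragredient action takes the inverse, which reverses once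
    more, so [dual_word w] acts on [V] as [wact h alpha w]. *)
Lemma dual_word_apply w l x : dual_word w l x = l (wact h alpha (rev w) x).
Proof.
elim: w x => [|i w IHw] x; first by rewrite /= id_lfunE.
by rewrite /= comp_lfunE dual_refl_apply IHw rev_cons -cats1 wact_cat.
Qed.

Lemma dual_word_cat w w' : dual_word (w ++ w') = (dual_word w \o dual_word w')%VF.
Proof. by elim: w => [|i w IHw] /=; rewrite ?comp_lfun1l // IHw comp_lfunA. Qed.

Lemma dual_wordK w : (dual_word (rev w) \o dual_word w = \1)%VF.
Proof.
apply/lfunP => l; apply/lfunP => x.
by rewrite -dual_word_cat dual_word_apply rev_cat revK wact_cat id_lfunE
  (wactK alpha_h).
Qed.

Lemma dual_word_inv w : ((dual_word w)^-1 = dual_word (rev w))%VF.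
Proof.
have ker0 : lker (dual_word w) == 0%VS.
  apply/lker0P => l m lm; have := congr1 (dual_word (rev w)) lm.
  by rewrite -!comp_lfunE dual_wordK !id_lfunE.
have wV : (dual_word w \o dual_word (rev w) = \1)%VF by rewrite -{1}[w]revK dual_wordK.
by rewrite -[LHS]comp_lfun1r -wV comp_lfunA lker0_compVf ?comp_lfun1l.
Qed.

Lemma coxeter_subgroupE (J : {set 'I_n}) s :
  coxeter_subgroup H L J s <-> exists2 w, all (mem J) w & s = dual_word w.
Proof.
split.
  elim=> [|{}s [i iJ /reflection_at_alongE ->]|{}s t _ [w wJ ->] _ [w' wJ' ->]|{}s _ [w wJ ->]].
  - by exists [::].
  - by exists [:: i]; rewrite /= ?andbT // comp_lfun1r.
  - by exists (w ++ w'); rewrite ?all_cat ?wJ // dual_word_cat.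
  - by exists (rev w); rewrite ?all_rev // dual_word_inv.
move=> [w + ->] {s}; elim: w => [_|i w IHw /= /andP[iJ /IHw wJ]].
  exact: generated_one.
apply: generated_comp wJ; apply: generated_incl; exists i => //.
exact/reflection_at_alongE.
Qed.

Lemma coxeter_groupE s : coxeter_group H L s <-> exists w, s = dual_word w.
Proof.
rewrite /coxeter_group coxeter_subgroupE; split=> [[w _ ->]|[w ->]]; first by exists w.
by exists w => //; apply/allP => i _; rewrite /= inE.
Qed.

Lemma dual_act_word w x : dual_act (dual_word w) x = wact h alpha w x.
Proof.
have actE l : (dual_word w)^-1%VF l x = l (wact h alpha w x).
  by rewrite dual_word_inv dual_word_apply revK.
rewrite /dual_act; case: xgetP => [y _ yP|/(_ (wact h alpha w x))]; last first.
  by case=> l; rewrite actE.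
by apply/eqP; rewrite -subr_eq0; apply/eqP/lfun_separates => l; rewrite linearB /= yP actE subrr.
Qed.

Lemma lcs_chamber_free w l : (forall i, 0 < (l (h i) : R)) ->
  (forall i, 0 < (l (wact h alpha w (h i)) : R)) -> forall x, wact h alpha w x = x.
Proof.
move=> lC lwC x.
have w1 : dual_word (rev w) = \1%VF.
  apply: contrapT => w1; have rwG : coxeter_group H L (dual_word (rev w)).
    by apply/coxeter_groupE; exists (rev w).
  have := lcs_chamber lcs rwG w1; rewrite -subset0 => /(_ (dual_word (rev w) l)); apply.
  split; first by exists l => //; exact/open_chamberE.
  by apply/open_chamberE => i; rewrite dual_word_apply revK.
apply/eqP; rewrite -subr_eq0; apply/eqP/lfun_separates => m.
by rewrite linearB /= -{1}[w]revK -dual_word_apply w1 id_lfunE subrr.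
Qed.

Lemma group_image_word (J : {set 'I_n}) (S : set V) :
  group_image (coxeter_subgroup H L J) S =
  [set z | exists2 w, all (mem J) w & S (wact h alpha w z)].
Proof.
apply/seteqP; split=> z.
  move=> [s /coxeter_subgroupE[w wJ ->] [x xS <-]]; rewrite dual_act_word.
  by exists (rev w); rewrite ?all_rev ?(wactK alpha_h).
move=> [w wJ wzS]; exists (dual_word (rev w)).
  by apply/coxeter_subgroupE; exists (rev w); rewrite ?all_rev.
by exists (wact h alpha w z); rewrite // dual_act_word (wactK alpha_h).
Qed.

Lemma imaginary_cone_word : imaginary_cone H L h alpha = orbit_cone h alpha.
Proof.
rewrite /imaginary_cone group_image_word; apply/seteqP; split=> z [w]; first by exists w.
by exists w => //; apply/allP => i _; rewrite /= inE.
Qed.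

Lemma special_face_word (T : {set 'I_n}) :
  special_face H L h alpha T = parabolic_face h alpha T.
Proof. exact: group_image_word. Qed.

Lemma face_orbit_word (F G : set V) :
  face_orbit H L F G <-> exists w, wact h alpha w @` F = G.
Proof.
have imE w : dual_act (dual_word w) @` F = wact h alpha w @` F.
  by congr (_ @` _); apply/funext => x; exact: dual_act_word.
split=> [[s /coxeter_groupE[w ->] <-]|[w <-]]; first by exists w; rewrite imE.
by exists (dual_word w); [apply/coxeter_groupE; exists w|exact: imE].
Qed.

End Translation.

Theorem theorem3p73 (R : realType) (V : vectType R) (n : nat)
    (H : 'I_n -> set V) (L : 'I_n -> set 'Hom(V, R^o))
    (h : 'I_n -> V) (alpha : 'I_n -> 'Hom(V, R^o))
    (lcs : linear_coxeter_system H L)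
    (h_in : forall i, H i (h i)) (alpha_in : forall i, L i (alpha i))
    (alpha_h : forall i, alpha i (h i) = 2) :
  (forall T : {set 'I_n}, special_facial h alpha T ->
     ri (special_face H L h alpha T) =
     group_image (coxeter_subgroup H L T) (K_open h alpha T)) /\
  (forall F : set V, Fa (imaginary_cone H L h alpha) F ->
     exists! T : {set 'I_n}, special_facial h alpha T /\
       face_orbit H L F (special_face H L h alpha T)) /\
  (forall F : set V, Fa (imaginary_cone H L h alpha) F ->
     ((exists T : {set 'I_n}, special_facial h alpha T /\
         F = special_face H L h alpha T) <->
      (ri F `&` coneK h alpha = ri F `&` oppset (dual_chamber alpha) /\
       ri F `&` coneK h alpha !=set0))).
Proof.
have rho := lcs_chamber_inhabited lcs h_in alpha_h.
have facet := lcs_facet_inhabited lcs h_in alpha_h.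
have free := lcs_chamber_free lcs h_in alpha_in alpha_h.
have faceE := special_face_word lcs h_in alpha_in alpha_h.
rewrite (imaginary_cone_word lcs h_in alpha_in alpha_h); split; [|split].
- move=> T Tsf; rewrite faceE (group_image_word lcs h_in alpha_in alpha_h).
  rewrite ri_core; [|by apply: parabolic_face_convex; case: Tsf|exact: parabolic_face_0].
  exact: core_parabolic_face.
- move=> F FFa.
  have [T [[Tsf TF] Tuniq]] := orbit_cone_face_orbit alpha_h rho facet free FFa.
  have orbE T' := face_orbit_word lcs h_in alpha_in alpha_h F (special_face H L h alpha T').
  exists T; split=> [|T' [T'sf /orbE]]; first by split=> //; apply/orbE; rewrite faceE.
  by rewrite faceE => T'F; apply: Tuniq.
- move=> F FFa; have [[Fc _ _] _] := FFa.
  rewrite ri_core //; last exact: Fa_0 (orbit_cone_0 _ _) FFa.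
  have := orbit_cone_special_face alpha_h rho facet free FFa.
  by under eq_exists do rewrite -faceE.
Qed.
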